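(* Let $\mathcal{N}\colon\mathcal{B}(\mathcal{H}_A)\to\mathcal{B}(\mathcal{H}_B)$ be a quantum channel and set $d_B=\dim\mathcal{H}_B$. Let $n,k\ge1$ be integers, let $|\psi_1\rangle,\dots,|\psi_k\rangle\in\mathcal{H}_A$ be unit vectors, let $(x_i)_{i=1}^k$ be a probability distribution, and let $\rho_{(n)}=\sum_{i=1}^k x_i\,|\psi_i\rangle\langle\psi_i|^{\otimes n}$. Set $\sigma_{ij}=\mathcal{N}(|\psi_i\rangle\langle\psi_j|)$ for $i,j=1,\dots,k$. For $\lambda\in\Lambda(n,d_B)$ let $$\bar q_\lambda=\sum_{i=1}^k x_i\operatorname{tr}q_\lambda(\sigma_{ii}),\qquad c_\lambda=\bar q_\lambda\,\dim S_\lambda,$$ and define the normalized states $$\sigma_\lambda=\frac{1}{\bar q_\lambda}\sum_{i=1}^k x_i\,q_\lambda(\sigma_{ii})\ \text{ on } V_\lambda^{d_B},\qquad \omega_\lambda=\frac{1}{\bar q_\lambda}\Bigl(\sqrt{x_ix_j}\;q_\lambda(\sigma_{ij})\Bigr)_{i,j=1}^k\ \text{ on } \mathbb{C}^k\otimes V_\lambda^{d_B},$$ the latter being the $k\times k$ block matrix whose $(i,j)$ block is $\frac{1}{\bar q_\lambda}\sqrt{x_ix_j}\,q_\lambda(\sigma_{ij})$. Then $$I_c(\mathcal{N}^{\otimes n},\rho_{(n)})=\sum_{\lambda\in\Lambda(n,d_B)}c_\lambda\bigl(S(\sigma_\lambda)-S(\omega_\lambda)\bigr),$$ where terms with $c_\lambda=0$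 are understood to be zero.
   Context: All Hilbert spaces are finite-dimensional over $\mathbb{C}$. A quantum state is a positive semidefinite operator of trace 1. A quantum channel is a linear completely positive trace-preserving map. $\log$ is base 2; $0\log0=0$; $S(\rho)=-\operatorname{tr}\rho\log\rho$ is the von Neumann entropy. The coherent information of a channel $\mathcal{N}$ and an input state $\rho$ is $I_c(\mathcal{N},\rho)=S(\mathcal{N}(\rho))-S((\mathcal{N}\otimes\mathrm{id}_R)(|\psi\rangle\langle\psi|))$, where $|\psi\rangle$ is any purification of $\rho$ with reference system $R$ (the value does not depend on the purification). $\Lambda(n,d)$ is the set of partitions $\lambda$ of $n$ into at most $d$ parts. For $\lambda\in\Lambda(n,d)$, $V_\lambda^d$ is the irreducible polynomial representation of $\mathrm{GL}(d)$ with highest weight $\lambda$, and $S_\lambda$ is the irreducible representation of the symmetric group $\mathfrak{S}_n$ indexed by $\lambda$. Schur-Weyl duality gives a unitary isomorphism $(\mathbb{C}^d)^{\otimes n}\cong\bigoplus_{\lambda\in\Lambda(n,d)}V_\lambda^d\otimes S_\lambda$ under which $X^{\otimes n}\cong\bigoplus_\lambda q_\lambda(X)\otimes \mathbb{1}_{S_\lambda}$ for $X\in\mathrm{GL}(d)$, where $q_\lambda\colon\mathrm{GL}(d)\to\mathrm{GL}(V_\lambda^d)$ is the representation, $V_\lambda^d$ being equipped with an inner product for which $q_\lambda$ is unitary on unitary matrices. Since the matrix entries of $q_\lambda$ are polynomial, $q_\lambda$ extends by continuity to all $d\times d$ matrices (not necessarily invertible or Hermitian), with the same identity for $X^{\otimes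 n}$. *)

(* Defs.v *)
From HB Require Import structures.
From mathcomp Require Import all_boot all_order all_fingroup all_algebra.
From mathcomp Require Import spectral complex mxtens.
From mathcomp Require Import classical_sets reals exp.
From mathcomp.multinomials Require mpoly.

Set Implicit Arguments.
Unset Strict Implicit.
Unset Printing Implicit Defensive.

Import Order.TTheory GRing.Theory Num.Theory.

Local Open Scope ring_scope.
Local Open Scope complex_scope.

(* Operators on C^a (x) C^b are matrices of size a * b, with the index
   conventions of the Kronecker product tensmx. *)

Section Quantum.
Variable R : realType.
Local Notation C := R[i].

Definition adjmx m n (A : 'M[C]_(m, n)) : 'M[C]_(n, m) :=
  map_mx Num.conj A^T.

Definition psdmx n (A : 'M[C]_n) : Prop :=
  A = adjmx A /\ forall v : 'cV[C]_n, 0 <= (adjmx v *m A *m v) ord0 ord0.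

Definition unit_vector n (v : 'cV[C]_n) : Prop := adjmx v *m v = 1%:M.

Definition ketbra n (u v : 'cV[C]_n) : 'M[C]_n := u *m adjmx v.

(* The linear map sending A *t B to N1 A *t N2 B, for linear N1 and N2. *)
Definition tens_map a1 b1 a2 b2
    (N1 : 'M[C]_a1 -> 'M[C]_b1) (N2 : 'M[C]_a2 -> 'M[C]_b2)
    (X : 'M[C]_(a1 * a2)) : 'M[C]_(b1 * b2) :=
  \sum_(i < a1) \sum_(j < a1) \sum_(k < a2) \sum_(l < a2)
    X (mxtens_index (i, k)) (mxtens_index (j, l)) *:
      (N1 (delta_mx i j) *t N2 (delta_mx k l)).

(* The recursion follows that of ntensmx, so that N^(x)n maps the n-th tensor
   power ntensmx X n to ntensmx (N X) n without any cast. *)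
Fixpoint tens_pow_rec a b (N : 'M[C]_a -> 'M[C]_b) k :
    'M[C]_(a ^ k.+1) -> 'M[C]_(b ^ k.+1) :=
  match k return 'M[C]_(a ^ k.+1) -> 'M[C]_(b ^ k.+1) with
  | 0 => N
  | k'.+1 => tens_map N (@tens_pow_rec a b N k')
  end.

Definition tens_pow a b (N : 'M[C]_a -> 'M[C]_b) k :
    'M[C]_(a ^ k) -> 'M[C]_(b ^ k) :=
  match k return 'M[C]_(a ^ k) -> 'M[C]_(b ^ k) with
  | 0 => id
  | k'.+1 => @tens_pow_rec a b N k'
  end.

Definition trace_preserving a b (N : 'M[C]_a -> 'M[C]_b) : Prop :=
  forall X, \tr (N X) = \tr X.

Definition completely_positive a b (N : 'M[C]_a -> 'M[C]_b) : Prop :=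
  forall r (X : 'M[C]_(a * r)),
    psdmx X -> psdmx (tens_map N (id : 'M[C]_r -> 'M[C]_r) X).

Definition quantum_channel a b (N : {linear 'M[C]_a -> 'M[C]_b}) : Prop :=
  completely_positive N /\ trace_preserving N.

(* Since ln 0 = 0, this takes the value 0 at 0, so 0 * log2 0 = 0. *)
Definition log2 (t : R) : R := ln t / ln 2.

(* Functional calculus; meaningful for A positive semidefinite, where
   A = invmx (spectralmx A) *m diag_mx (spectral_diag A) *m spectralmx A. *)
Definition log2mx n (A : 'M[C]_n) : 'M[C]_n :=
  invmx (spectralmx A)
    *m diag_mx (map_mx (fun z : C => (log2 (complex.Re z))%:C) (spectral_diag A))
    *m spectralmx A.

Definition entropy n (A : 'M[C]_n) : R :=
  - complex.Re (\tr (A *m log2mx A)).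

Definition partial_trace2 a r (X : 'M[C]_(a * r)) : 'M[C]_a :=
  \matrix_(i, j) \sum_(k < r) X (mxtens_index (i, k)) (mxtens_index (j, k)).

Definition purification a r (rho : 'M[C]_a) (psi : 'cV[C]_(a * r)) : Prop :=
  partial_trace2 (ketbra psi psi) = rho.

(* The value at some purification psi of rho, chosen by xget. *)
Definition coherent_information a b (N : 'M[C]_a -> 'M[C]_b)
    (rho : 'M[C]_a) : R :=
  xget 0 [set v | exists r (psi : 'cV[C]_(a * r)),
    purification rho psi /\
    v = entropy (N rho)
        - entropy (tens_map N (id : 'M[C]_r -> 'M[C]_r) (ketbra psi psi))].

End Quantum.

Arguments tens_pow_rec {R a b} N k X.
Arguments tens_pow {R a b} N k X.

(* Partitions of n into at most d parts, padded with zeros to length d. *)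
Definition is_partition n d (lam : {ffun 'I_d -> 'I_n.+1}) : bool :=
  [forall i : 'I_d, forall j : 'I_d, (i <= j)%N ==> (lam j <= lam i)%N]
  && (\sum_(i < d) lam i == n)%N.

Definition partition_of n d : finType :=
  {lam : {ffun 'I_d -> 'I_n.+1} | is_partition lam}.

Definition part n d (lam : partition_of n d) (i : 'I_d) : nat := sval lam i.

Section Representations.
Variable R : realType.
Local Notation C := R[i].

Definition polynomial_map d D (q : 'M[C]_d -> 'M[C]_D) : Prop :=
  forall i j, exists P : mpoly.mpoly (d * d) C,
    forall X, q X i j = mpoly.meval (fun s => mxvec X ord0 s) P.

(* A representation of GL(d) on C^D with polynomial matrix entries. Such a q is
   continuous, so its values at singular matrices are the extension by
   continuity of its values on GL(d), which is dense. *)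
Definition polynomial_representation d D (q : 'M[C]_d -> 'M[C]_D) : Prop :=
  [/\ polynomial_map q,
      q 1%:M = 1%:M
    & {in unitmx &, forall X Y, q (X *m Y) = q X *m q Y}].

(* q X acts on column vectors, whereas stablemx and row_full refer to row
   spaces: the rows of W are the transposes of vectors spanning a subspace. *)
Definition irreducible_representation d D (q : 'M[C]_d -> 'M[C]_D) : Prop :=
  (0 < D)%N /\
  forall W : 'M[C]_D,
    {in unitmx, forall X, stablemx W (q X)^T} -> W = 0 \/ row_full W.

(* There is a vector of weight lam fixed by the upper unitriangular group. *)
Definition has_highest_weight n d (lam : partition_of n d) D
    (q : 'M[C]_d -> 'M[C]_D) : Prop :=
  exists2 v : 'cV[C]_D, v != 0 &
    (forall t : 'rV[C]_d, (forall i, t ord0 i != 0) ->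
       q (diag_mx t) *m v = (\prod_(i < d) t ord0 i ^+ part lam i) *: v) /\
    (forall X : 'M[C]_d, (forall i, X i i = 1) ->
       (forall i j : 'I_d, (j < i)%N -> X i j = 0) -> q X *m v = v).

Definition unitary_on_unitaries d D (q : 'M[C]_d -> 'M[C]_D) : Prop :=
  {in unitarymx, forall U : 'M[C]_d, q U \is unitarymx}.

(* q is V_lam^d in coordinates with respect to an orthonormal basis. *)
Definition is_weyl_representation n d (lam : partition_of n d) D
    (q : 'M[C]_d -> 'M[C]_D) : Prop :=
  [/\ polynomial_representation q,
      irreducible_representation q,
      has_highest_weight lam q
    & unitary_on_unitaries q].

(* S_lam is the Specht module. A tableau T sends each l : 'I_n to the
   (row, column) position of the entry l in the Young diagram of lam; it is
   onto since the diagram has n boxes. A tabloid is the map sending each entry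
   to its row. *)
Definition is_tableau n d (lam : partition_of n d)
    (T : {ffun 'I_n -> 'I_d * 'I_n}) : bool :=
  injectiveb T && [forall l, (T l).2 < part lam (T l).1]%N.

Definition tabloid n d (T : {ffun 'I_n -> 'I_d * 'I_n}) : {ffun 'I_n -> 'I_d} :=
  [ffun l => (T l).1].

Definition in_column_stabilizer n d (T : {ffun 'I_n -> 'I_d * 'I_n})
    (s : 'S_n) : bool :=
  [forall l, (T (s l)).2 == (T l).2].

Definition polytabloid n d (T : {ffun 'I_n -> 'I_d * 'I_n}) :
    {ffun {ffun 'I_n -> 'I_d} -> C^o} :=
  [ffun w => \sum_(s : 'S_n | in_column_stabilizer T s)
     (-1) ^+ s * (w == tabloid [ffun l => T (s l)])%:R].

Definition specht_module n d (lam : partition_of n d) :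
    {vspace {ffun {ffun 'I_n -> 'I_d} -> C^o}} :=
  <<[seq polytabloid T | T : {ffun 'I_n -> 'I_d * 'I_n} in is_tableau lam]>>%VS.

Definition dim_specht n d (lam : partition_of n d) : nat :=
  \dim (specht_module lam).

End Representations.

(* Main.v *)
Require Import Defs.
From HB Require Import structures.
From mathcomp Require Import all_boot all_order all_fingroup all_algebra.
From mathcomp Require Import spectral complex mxtens.
From mathcomp Require Import classical_sets reals exp.
From mathcomp.multinomials Require mpoly.
From mathcomp Require Import fintype finset ring.

Set Implicit Arguments.
Unset Strict Implicit.
Unset Printing Implicit Defensive.

Import Order.TTheory GRing.Theory Num.Theory.

Local Open Scope complex_scope.
Local Open Scope ring_scope.

(** Writing the canonical purification of rho_(n) as
    sum_i sqrt(x_i) psi_i^(x)n (x) e_i, the output states are sums of matrix units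
    tensored with the powers sigma_ij^(x)n.  Schur-Weyl duality splits them into the
    blocks q_lam(sigma_ij), each with multiplicity dim S_lam, and the entropy of an
    orthogonal direct sum is the sum of the entropies.

    Schur-Weyl duality is obtained from matrix coefficients: by Gauss decomposition,
    <v, q(X) w> only depends on <v, w> and on the weight when v and w are highest
    weight vectors.  Hence the cyclic modules generated by unit highest weight
    vectors of the same weight are isometric, which embeds V_lam in the tensor power
    once for each element of an orthonormal basis of the highest weight vectors of
    weight lam.  These vectors form the Specht module: polytabloids are highest
    weight vectors; conversely, the projector onto the Specht module commutes with
    the symmetric group, so by polarization it is a combination of tensor powers
    X^(x)n, and its coefficient at a unit highest weight vector of weight lam is the
    same as at a normalized polytabloid, namely 1. *)

(** * Entropy and functional calculus *)

(** The matrices [sigma i j] need be neither Hermitian nor invertible, so every property of [q] has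
    to hold on all matrices. Multiplicativity, the rule q (adjmx X) = adjmx (q X) and the
    coefficient formula are polynomial identities; each is checked at enough points and carried over
    along lines of matrices, where a polynomial in one variable with infinitely many zeros vanishes.
    The adjoint rule turns inner products of orbit vectors q(X) v into coefficients at v; this
    yields the isometries and the orthogonality of the copies. Completeness of the decomposition is
    a kernel argument. The projector onto the sum of the embedded copies commutes with all tensor
    powers; a nonzero kernel would contain a highest weight vector, found by descent on the sum of
    letters, whose weight is a partition. Such a vector lies in a Specht module, which the projector
    fixes pointwise. [log2mx] refers to one chosen spectral decomposition, so entropies are compared
    through intertwiners: A J = J B passes to functions of A and B. Dividing by [qbar] is harmless
    because both blocks have this trace, so the logarithms of the trace cancel. *)

Section Adjoint.
Variable R : realType.
Local Notation C := R[i].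

Lemma adjmxE m n (A : 'M[C]_(m, n)) i j : adjmx A i j = (A j i)^*.
Proof. by rewrite !mxE. Qed.

Lemma adjmxK m n (A : 'M[C]_(m, n)) : adjmx (adjmx A) = A.
Proof. by apply/matrixP => i j; rewrite !adjmxE conjCK. Qed.

Lemma adjmx_mul m n p (A : 'M[C]_(m, n)) (B : 'M[C]_(n, p)) :
  adjmx (A *m B) = adjmx B *m adjmx A.
Proof. by rewrite /adjmx trmx_mul map_mxM. Qed.

Lemma adjmxD m n (A B : 'M[C]_(m, n)) : adjmx (A + B) = adjmx A + adjmx B.
Proof. by apply/matrixP => i j; rewrite !mxE rmorphD. Qed.

Lemma adjmxN m n (A : 'M[C]_(m, n)) : adjmx (- A) = - adjmx A.
Proof. by apply/matrixP => i j; rewrite !mxE rmorphN. Qed.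

Lemma adjmxB m n (A B : 'M[C]_(m, n)) : adjmx (A - B) = adjmx A - adjmx B.
Proof. by rewrite adjmxD adjmxN. Qed.

Lemma adjmx0 m n : adjmx (0 : 'M[C]_(m, n)) = 0.
Proof. by apply/matrixP => i j; rewrite !mxE rmorph0. Qed.

Lemma adjmxZ m n a (A : 'M[C]_(m, n)) : adjmx (a *: A) = a^* *: adjmx A.
Proof. by apply/matrixP => i j; rewrite !mxE rmorphM. Qed.

Lemma adjmx_sum m n I (r : seq I) (P : pred I) (F : I -> 'M[C]_(m, n)) :
  adjmx (\sum_(i <- r | P i) F i) = \sum_(i <- r | P i) adjmx (F i).
Proof. by apply: (big_morph _ (@adjmxD _ _)); exact: adjmx0. Qed.

Lemma adjmx_scalar n (a : C) : adjmx (a%:M : 'M[C]_n) = a^*%:M.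
Proof. by rewrite /adjmx tr_scalar_mx map_scalar_mx. Qed.

Lemma adjmx1 n : adjmx (1%:M : 'M[C]_n) = 1%:M.
Proof. by rewrite adjmx_scalar rmorph1. Qed.

Lemma adjmx_diag n (t : 'rV[C]_n) : adjmx (diag_mx t) = diag_mx (map_mx Num.conj t).
Proof. by rewrite /adjmx tr_diag_mx map_diag_mx. Qed.

Lemma adjmx_delta m n (i : 'I_m) (j : 'I_n) :
  adjmx (delta_mx i j : 'M[C]_(m, n)) = delta_mx j i.
Proof. by rewrite /adjmx trmx_delta map_delta_mx. Qed.

Lemma adjmx_tens m n p q (A : 'M[C]_(m, n)) (B : 'M[C]_(p, q)) :
  adjmx (A *t B) = adjmx A *t adjmx B.
Proof. by apply/matrixP => i j; rewrite !mxE rmorphM. Qed.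

Lemma adj_mul_ge0 n (v : 'cV[C]_n) : 0 <= (adjmx v *m v) 0 0.
Proof.
by rewrite mxE sumr_ge0 // => i _; rewrite adjmxE mulrC mul_conjC_ge0.
Qed.

Lemma adj_mul_eq0 n (v : 'cV[C]_n) : adjmx v *m v = 0 -> v = 0.
Proof.
move=> /matrixP /(_ 0 0); rewrite !mxE => v0.
have : \sum_j v j 0 * (v j 0)^* = 0.
  by rewrite -[RHS]v0; apply: eq_bigr => j _; rewrite adjmxE mulrC.
move=> /psumr_eq0P h; apply/matrixP => i j; rewrite ord1 mxE.
by apply/eqP; rewrite -mul_conjC_eq0; apply/eqP/h => // k _; exact: mul_conjC_ge0.
Qed.

Lemma adj_mul_gt0 n (v : 'cV[C]_n) : v != 0 -> 0 < (adjmx v *m v) 0 0.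
Proof.
move=> v0; rewrite lt_def adj_mul_ge0 andbT; apply: contra v0 => /eqP h.
by apply/eqP/adj_mul_eq0/matrixP => i j; rewrite !ord1 h mxE.
Qed.

Definition hermitianmx n (A : 'M[C]_n) := adjmx A = A.

Lemma hermitian_normal n (A : 'M[C]_n) : hermitianmx A -> A \is normalmx.
Proof.
move=> hA; apply/normalmxP.
by have -> : (A^T ^ Num.conj)%sesqui = A by exact: hA.
Qed.

Lemma unitary_adjP m n (A : 'M[C]_(m, n)) : A *m adjmx A = 1%:M <-> A \is unitarymx.
Proof. by split => [h|/unitarymxP h]; [apply/unitarymxP|]. Qed.

Lemma unitary_adj_mul n (A : 'M[C]_n) : A \is unitarymx -> adjmx A *m A = 1%:M.
Proof. by move/unitary_adjP/mulmx1C. Qed.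

Lemma invmx_unitary_adj n (A : 'M[C]_n) : A \is unitarymx -> invmx A = adjmx A.
Proof. exact: invmx_unitary. Qed.

Lemma hermitian_adj_mul m n (A : 'M[C]_n) (B : 'M[C]_(n, m)) :
  hermitianmx A -> hermitianmx (adjmx B *m A *m B).
Proof. by move=> hA; rewrite /hermitianmx !adjmx_mul adjmxK hA mulmxA. Qed.

End Adjoint.

Section FunctionalCalculus.
Variable R : realType.
Local Notation C := R[i].

(** [log2mx] with an arbitrary function: besides the logarithm, [entropy_mulC] needs log2 z / z. *)
Definition funmx (g : C -> C) n (A : 'M[C]_n) : 'M[C]_n :=
  invmx (spectralmx A) *m diag_mx (map_mx g (spectral_diag A)) *m spectralmx A.

Lemma log2mxE n (A : 'M[C]_n) :
  log2mx A = funmx (fun z => (log2 (complex.Re z))%:C) A.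
Proof. by []. Qed.

Lemma conj_mulmx n (P Q A B : 'M[C]_n) : P *m Q = 1%:M ->
  (Q *m A *m P) *m (Q *m B *m P) = Q *m (A *m B) *m P.
Proof. by move=> PQ; rewrite -!mulmxA (mulmxA P) PQ mul1mx. Qed.

Lemma mxtrace_conj n (P Q A : 'M[C]_n) : P *m Q = 1%:M ->
  \tr (Q *m A *m P) = \tr A.
Proof. by move=> PQ; rewrite mxtrace_mulC mulmxA PQ mul1mx. Qed.

(** A nonzero entry [K i j] forces [d 0 i = e 0 j]; at a zero entry both sides vanish. *)
Lemma diag_intertwine (g : C -> C) m n (d : 'rV[C]_m) (e : 'rV[C]_n) (K : 'M[C]_(m, n)) :
  diag_mx d *m K = K *m diag_mx e ->
  diag_mx (map_mx g d) *m K = K *m diag_mx (map_mx g e).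
Proof.
rewrite !mul_diag_mx !mul_mx_diag => /matrixP h.
apply/matrixP => i j; have := h i j; rewrite !mxE => {}h.
have [->|k0] := eqVneq (K i j) 0; first by rewrite mulr0 mul0r.
suff -> : d 0 i = e 0 j by rewrite mulrC.
by apply: (mulIf k0); rewrite h mulrC.
Qed.

Lemma funmx_diag_intertwine (g : C -> C) m n (P : 'M[C]_m) (d : 'rV[C]_m)
    (Q : 'M[C]_n) (e : 'rV[C]_n) (J : 'M[C]_(m, n)) :
  P \in unitmx -> Q \in unitmx ->
  (invmx P *m diag_mx d *m P) *m J = J *m (invmx Q *m diag_mx e *m Q) ->
  (invmx P *m diag_mx (map_mx g d) *m P) *m J =
  J *m (invmx Q *m diag_mx (map_mx g e) *m Q).
Proof.
move=> uP uQ h.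
have := @diag_intertwine g _ _ d e (P *m J *m invmx Q).
have -> : diag_mx d *m (P *m J *m invmx Q) = P *m J *m invmx Q *m diag_mx e.
  have -> : diag_mx d *m (P *m J *m invmx Q) =
     P *m ((invmx P *m diag_mx d *m P) *m J) *m invmx Q.
    by rewrite !mulmxA (mulmxV uP) mul1mx.
  by rewrite h -!mulmxA (mulmxV uQ) mulmx1.
move=> /(_ erefl) {}h.
have -> : invmx P *m diag_mx (map_mx g d) *m P *m J =
    invmx P *m (diag_mx (map_mx g d) *m (P *m J *m invmx Q)) *m Q.
  by rewrite -!mulmxA (mulVmx uQ) mulmx1.
by rewrite h !mulmxA (mulVmx uP) mul1mx.
Qed.

Lemma funmx_intertwine (g : C -> C) m n (A : 'M[C]_m) (B : 'M[C]_n) (J : 'M[C]_(m, n)) :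
  hermitianmx A -> hermitianmx B -> A *m J = J *m B ->
  funmx g A *m J = J *m funmx g B.
Proof.
move=> /hermitian_normal /orthomx_spectralP eA /hermitian_normal /orthomx_spectralP eB.
rewrite {1}eA {1}eB /funmx.
by apply: funmx_diag_intertwine; exact: spectral_unit.
Qed.

(** The intertwiner J = 1 between two diagonalizations of A shows that the choice made by
    [spectralmx] does not matter. *)
Lemma funmx_diagonalized (g : C -> C) n (A P : 'M[C]_n) (d : 'rV[C]_n) :
  hermitianmx A -> P \in unitmx -> A = invmx P *m diag_mx d *m P ->
  funmx g A = invmx P *m diag_mx (map_mx g d) *m P.
Proof.
move=> /hermitian_normal /orthomx_spectralP eA uP eP.
rewrite -[LHS]mulmx1 -[RHS]mul1mx.
apply: funmx_diag_intertwine; [exact: spectral_unit | exact: uP |].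
by rewrite mulmx1 mul1mx -eP [RHS]eA.
Qed.

Lemma entropy_diagonalized n (A P : 'M[C]_n) (d : 'rV[C]_n) :
  hermitianmx A -> P \in unitmx -> A = invmx P *m diag_mx d *m P ->
  entropy A = - complex.Re (\sum_i d 0 i * (log2 (complex.Re (d 0 i)))%:C).
Proof.
move=> hA uP eA; rewrite /entropy log2mxE (funmx_diagonalized _ hA uP eA) {1}eA.
congr (- complex.Re _).
move: (invmx P) (mulmxV uP) => Q PQ.
rewrite (conj_mulmx _ _ PQ) (mxtrace_conj _ PQ) mulmx_diag mxtrace_diag.
by apply: eq_bigr => i _; rewrite !mxE.
Qed.

(** Inserting the resolution of the identity splits the trace; in each term the logarithm crosses
    [J a] as an intertwiner, and cyclicity cancels [J a] against its adjoint. *)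
Lemma entropy_direct_sum n (I : finType) (p : I -> nat) (X : 'M[C]_n)
    (J : forall a, 'M[C]_(n, p a)) (Y : forall a, 'M[C]_(p a)) :
  hermitianmx X -> (forall a, hermitianmx (Y a)) ->
  (forall a, X *m J a = J a *m Y a) -> (forall a, adjmx (J a) *m J a = 1%:M) ->
  \sum_a J a *m adjmx (J a) = 1%:M ->
  entropy X = \sum_a entropy (Y a).
Proof.
move=> hX hY XJ JJ sJ; rewrite /entropy sumrN; congr (- _).
rewrite -raddf_sum /=; congr (complex.Re _).
rewrite -[X *m _]mulmx1 -sJ mulmx_sumr raddf_sum /=; apply: eq_bigr => a _.
rewrite mulmxA -(mulmxA X) !log2mxE (funmx_intertwine _ hX (hY a) (XJ a)).
rewrite mulmxA XJ -!mulmxA mxtrace_mulC -!mulmxA JJ mulmx1.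
by rewrite /funmx !mulmxA.
Qed.

(** Both operators have the nonzero spectrum of [B *m A]. This serves to compare two purifications,
    whose reference systems may differ in dimension. *)
Lemma entropy_mulC m n p (A : 'M[C]_(m, n)) (B : 'M[C]_(n, m))
    (A' : 'M[C]_(p, n)) (B' : 'M[C]_(n, p)) :
  hermitianmx (A *m B) -> hermitianmx (A' *m B') -> B *m A = B' *m A' ->
  entropy (A *m B) = entropy (A' *m B').
Proof.
move=> hX hX' BA.
(* [z * log2 z = z^2 * h z], so that the logarithm can be moved across [A]. *)
pose h (z : C) : C := (log2 (complex.Re z))%:C / z.
have logE k (X : 'M[C]_k) : hermitianmx X -> X *m log2mx X = X *m X *m funmx h X.
  move=> /hermitian_normal /orthomx_spectralP; rewrite log2mxE /funmx.
  move: (spectralmx X) (spectral_diag X) (spectral_unit X) => P d uP ->.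
  move: (invmx P) (mulmxV uP) => Q PQ.
  apply: etrans (conj_mulmx _ _ PQ) (esym _).
  apply: etrans (congr1 (mulmx^~ _) (conj_mulmx _ _ PQ)) _.
  apply: etrans (conj_mulmx _ _ PQ) _.
  rewrite !mulmx_diag; congr (_ *m diag_mx _ *m _).
  apply/rowP => i; rewrite !mxE.
  have [->|z0] := eqVneq (d 0 i) 0; first by rewrite !mul0r.
  by rewrite -mulrA [d 0 i * (_ / _)]mulrC divfK.
(* [A *m B'] intertwines the two operators, so any function of one can be exchanged for the same
   function of the other. *)
have XJ : (A *m B) *m (A *m B') = (A *m B') *m (A' *m B').
  by rewrite -!mulmxA (mulmxA B) BA -!mulmxA.
rewrite /entropy (logE _ _ hX) (logE _ _ hX').
congr (- complex.Re _).
move: (funmx h _) (funmx h _) (funmx_intertwine h hX hX' XJ) => F' F FJ.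
have -> : A *m B *m (A *m B) *m F = A *m B' *m (A' *m B *m F).
  by rewrite -!mulmxA (mulmxA B) BA -!mulmxA.
rewrite mxtrace_mulC -[_ *m F *m _]mulmxA FJ [in LHS]mulmxA mxtrace_mulC.
have <- : A' *m B *m (A *m B') = A' *m B' *m (A' *m B').
  by rewrite -!mulmxA (mulmxA B) BA -!mulmxA.
by rewrite mxtrace_mulC.
Qed.

(** Checked eigenvalue by eigenvalue; zero eigenvalues are treated apart, since the logarithm of a
    product splits only for positive factors. The equation lives in C because [\tr A] does. *)
Lemma entropy_scale n (A P : 'M[C]_n) (d : 'rV[C]_n) (c : R) :
  0 < c -> hermitianmx A -> P \in unitmx -> A = invmx P *m diag_mx d *m P ->
  (forall i, 0 <= d 0 i) ->
  (c * entropy (c%:C^-1 *: A))%:C = (entropy A)%:C + \tr A * (log2 c)%:C.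
Proof.
move=> c0 hA uP eA d0.
have hcA : hermitianmx (c%:C^-1 *: A).
  by rewrite /hermitianmx adjmxZ hA; congr (_ *: _); rewrite conj_Creal // realV complex_real.
have ecA : c%:C^-1 *: A = invmx P *m diag_mx (c%:C^-1 *: d) *m P.
  by rewrite eA linearZ /= -scalemxAr -scalemxAl.
rewrite (entropy_diagonalized hcA uP ecA) (entropy_diagonalized hA uP eA).
have -> : \tr A = \sum_i d 0 i.
  by rewrite eA (mxtrace_conj _ (mulmxV uP)) mxtrace_diag.
have cC : c%:C != 0 by rewrite eq_complex /= eqxx andbT gt_eqF.
have dE i : d 0 i = (complex.Re (d 0 i))%:C by rewrite RRe_real // ger0_real.
pose r i := complex.Re (d 0 i).
have -> : \sum_i d 0 i = (\sum_i r i)%:C.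
  by rewrite raddf_sum; apply: eq_bigr => i _; exact: dE.
have -> : \sum_i d 0 i * (log2 (complex.Re (d 0 i)))%:C = (\sum_i r i * log2 (r i))%:C.
  rewrite raddf_sum; apply: eq_bigr => i _; rewrite {1}dE /=.
  by rewrite -[LHS](rmorphM (real_complex R)).
have -> : \sum_i (c%:C^-1 *: d) 0 i * (log2 (complex.Re ((c%:C^-1 *: d) 0 i)))%:C =
    (\sum_i c^-1 * r i * log2 (c^-1 * r i))%:C.
  rewrite raddf_sum; apply: eq_bigr => i _; rewrite !mxE dE -fmorphV /=.
  by rewrite -(rmorphM (real_complex R)) /= -(rmorphM (real_complex R)) mulr0 subr0.
rewrite /= -(rmorphM (real_complex R)) -(rmorphD (real_complex R)); congr (_%:C).
rewrite mulrN mulr_sumr mulr_suml -!sumrN -big_split /=; apply: eq_bigr => i _.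
have r0 : 0 <= r i by have := d0 i; rewrite dE ler0c.
rewrite /log2; move: r0; rewrite le_eqVlt => /orP[/eqP<-|r0]; first by rewrite !(mulr0, mul0r); ring.
rewrite lnM ?posrE ?invr_gt0 // lnV ?posrE //.
have l2 : ln 2 != 0 :> R by rewrite gt_eqF // ln_gt0 // ltr1n.
field.
by rewrite l2 gt_eqF.
Qed.

Lemma entropy0 n : entropy (0 : 'M[C]_n) = 0.
Proof. by rewrite /entropy mul0mx raddf0 /= oppr0. Qed.

End FunctionalCalculus.

(** * Purifications and coherent information *)

Section TensorMaps.
Variable R : realType.
Local Notation C := R[i].

Definition hermitian_preserving a b (T : 'M[C]_a -> 'M[C]_b) :=
  forall X, T (adjmx X) = adjmx (T X).

Lemma linear_sum a b (T : 'M[C]_a -> 'M[C]_b) I (r : seq I) (F : I -> 'M[C]_a) :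
  linear T -> T (\sum_(i <- r) F i) = \sum_(i <- r) T (F i).
Proof.
move=> lT; elim: r => [|i r IHr].
  by rewrite !big_nil; have := lT (-1) 0 0; rewrite scaler0 addr0 scaleN1r addNr.
by rewrite !big_cons -IHr -[F i]scale1r lT !scale1r.
Qed.

Lemma linear_scale a b (T : 'M[C]_a -> 'M[C]_b) c X :
  linear T -> T (c *: X) = c *: T X.
Proof.
move=> lT; have T0 : T 0 = 0 by have := lT (-1) 0 0; rewrite scaler0 addr0 scaleN1r addNr.
by rewrite -[c *: X]addr0 lT T0 addr0.
Qed.

Lemma tens_map_linear a1 b1 a2 b2 (N1 : 'M[C]_a1 -> 'M[C]_b1) (N2 : 'M[C]_a2 -> 'M[C]_b2) :
  linear (tens_map N1 N2).
Proof.
move=> c X Y; rewrite /tens_map; do 4![rewrite scaler_sumr -big_split; apply: eq_bigr => ? _ /=].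
by rewrite !mxE scalerDl scalerA.
Qed.

Lemma tensmx_scalel m n p q c (A : 'M[C]_(m, n)) (B : 'M[C]_(p, q)) :
  (c *: A) *t B = c *: (A *t B).
Proof. by apply/matrixP => i j; rewrite !mxE mulrA. Qed.

Lemma tensmx_scaler m n p q c (A : 'M[C]_(m, n)) (B : 'M[C]_(p, q)) :
  A *t (c *: B) = c *: (A *t B).
Proof. by apply/matrixP => i j; rewrite !mxE mulrCA. Qed.

Lemma tensmx_suml m n p q I (r : seq I) (F : I -> 'M[C]_(m, n)) (B : 'M[C]_(p, q)) :
  (\sum_(i <- r) F i) *t B = \sum_(i <- r) (F i *t B).
Proof. by apply/matrixP => i j; rewrite !(mxE, summxE) mulr_suml; apply: eq_bigr => k _; rewrite !mxE. Qed.

Lemma tensmx_sumr m n p q I (r : seq I) (F : I -> 'M[C]_(p, q)) (A : 'M[C]_(m, n)) :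
  A *t (\sum_(i <- r) F i) = \sum_(i <- r) (A *t F i).
Proof. by apply/matrixP => i j; rewrite !(mxE, summxE) mulr_sumr; apply: eq_bigr => k _; rewrite !mxE. Qed.

Lemma linear_mx_delta a b (T : 'M[C]_a -> 'M[C]_b) X : linear T ->
  T X = \sum_i \sum_j X i j *: T (delta_mx i j).
Proof.
move=> lT; rewrite {1}[X]matrix_sum_delta linear_sum //; apply: eq_bigr => i _.
by rewrite linear_sum //; apply: eq_bigr => j _; rewrite linear_scale.
Qed.

Lemma tens_map_tens a1 b1 a2 b2 (N1 : 'M[C]_a1 -> 'M[C]_b1) (N2 : 'M[C]_a2 -> 'M[C]_b2) A B :
  linear N1 -> linear N2 -> tens_map N1 N2 (A *t B) = N1 A *t N2 B.
Proof.
move=> l1 l2; rewrite /tens_map (linear_mx_delta A l1) (linear_mx_delta B l2).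
rewrite tensmx_suml; apply: eq_bigr => i _.
rewrite tensmx_suml; apply: eq_bigr => j _.
rewrite tensmx_sumr; apply: eq_bigr => k _.
rewrite tensmx_sumr; apply: eq_bigr => l _.
by rewrite tensmxE tensmx_scaler tensmx_scalel scalerA mulrC.
Qed.

Lemma tens_map_hermitian a1 b1 a2 b2 (N1 : 'M[C]_a1 -> 'M[C]_b1) (N2 : 'M[C]_a2 -> 'M[C]_b2) :
  hermitian_preserving N1 -> hermitian_preserving N2 ->
  hermitian_preserving (tens_map N1 N2).
Proof.
move=> h1 h2 X; rewrite /tens_map adjmx_sum exchange_big; apply: eq_bigr => i _ /=.
rewrite adjmx_sum; apply: eq_bigr => j _; rewrite adjmx_sum exchange_big.
apply: eq_bigr => k _ /=; rewrite adjmx_sum; apply: eq_bigr => l _.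
by rewrite adjmxZ adjmx_tens adjmxE -h1 -h2 !adjmx_delta.
Qed.

Lemma tens_pow_linear a b (N : 'M[C]_a -> 'M[C]_b) n : linear N -> linear (tens_pow N n).
Proof.
move=> lN; case: n => [//|n] /=.
by elim: n => [//|n IH]; exact: tens_map_linear.
Qed.

Lemma tens_pow_hermitian a b (N : 'M[C]_a -> 'M[C]_b) n :
  hermitian_preserving N -> hermitian_preserving (tens_pow N n).
Proof.
move=> hN; case: n => [//|n] /=.
by elim: n => [//|n IH]; exact: tens_map_hermitian.
Qed.

Lemma tens_pow_ntens a b (N : 'M[C]_a -> 'M[C]_b) n X : linear N ->
  tens_pow N n (ntensmx X n) = ntensmx (N X) n.
Proof.
move=> lN; case: n => [//|n] /=.
elim: n => [//|n IH] /=.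
by rewrite tens_map_tens ?IH //; have := tens_pow_linear (n := n.+1) lN.
Qed.

Lemma ntensmx_mul m n p (A : 'M[C]_(m, n)) (B : 'M[C]_(n, p)) k :
  ntensmx (A *m B) k = ntensmx A k *m ntensmx B k.
Proof.
case: k => [|k] /=; first by rewrite mul1mx.
by elim: k => [//|k IH] /=; rewrite !ntensmxSS IH tensmx_mul.
Qed.

Lemma adj_ntensmx m n (A : 'M[C]_(m, n)) k : adjmx (ntensmx A k) = ntensmx (adjmx A) k.
Proof.
case: k => [|k] /=; first exact: adjmx1.
by elim: k => [//|k IH] /=; rewrite !ntensmxSS -IH adjmx_tens.
Qed.

(** The width of [ntensmx v n] is [1 ^ n]; the cast makes it a column vector. *)
Definition tens_vec a (v : 'cV[C]_a) n : 'cV[C]_(a ^ n) :=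
  castmx (erefl, exp1n n) (ntensmx v n).

Lemma ketbra_tens_vec a (v w : 'cV[C]_a) n :
  ketbra (tens_vec v n) (tens_vec w n) = ntensmx (ketbra v w) n.
Proof.
rewrite /ketbra ntensmx_mul -adj_ntensmx /tens_vec.
move: (ntensmx v n) (ntensmx w n) (exp1n n); move: (1 ^ n)%N => p V W e.
by subst p; rewrite !castmx_id.
Qed.

Lemma block_entry m n k (F : 'I_k -> 'I_k -> 'M[C]_(m, n)) b i c j :
  (\sum_i \sum_j (F i j *t delta_mx i j)) (mxtens_index (b, i)) (mxtens_index (c, j)) =
  F i j b c.
Proof.
rewrite summxE (bigD1 i) //= [X in _ + X]big1 ?addr0 => [|l /negPf h]; last first.
  by rewrite summxE big1 // => l' _; rewrite tensmxE !mxE [i == l]eq_sym h mulr0.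
rewrite summxE (bigD1 j) //= [X in _ + X]big1 ?addr0 => [|l /negPf h]; last first.
  by rewrite tensmxE !mxE [j == l]eq_sym h andbF mulr0.
by rewrite tensmxE !mxE !eqxx mulr1.
Qed.

(** The vector sum_i w_i (x) e_i, with reference system C^k. *)
Definition stack a k (w : 'I_k -> 'cV[C]_a) : 'cV[C]_(a * k) :=
  \col_p w (mxtens_unindex p).2 (mxtens_unindex p).1 0.

Lemma ketbra_stack a k (w : 'I_k -> 'cV[C]_a) :
  ketbra (stack w) (stack w) = \sum_i \sum_j (ketbra (w i) (w j) *t delta_mx i j).
Proof.
apply/matrixP => p q; case: (mxtens_indexP p) => b i; case: (mxtens_indexP q) => c j.
by rewrite (block_entry (fun i j => ketbra (w i) (w j))) !mxE !big_ord1 !mxE !mxtens_indexK.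
Qed.

Lemma tens_map_stack a b k (T : 'M[C]_a -> 'M[C]_b) (w : 'I_k -> 'cV[C]_a) :
  linear T ->
  tens_map T id (ketbra (stack w) (stack w)) =
  \sum_i \sum_j (T (ketbra (w i) (w j)) *t delta_mx i j).
Proof.
move=> lT; rewrite ketbra_stack linear_sum; last exact: tens_map_linear.
apply: eq_bigr => i _; rewrite linear_sum; last exact: tens_map_linear.
by apply: eq_bigr => j _; rewrite tens_map_tens.
Qed.

Lemma purification_stack a k (w : 'I_k -> 'cV[C]_a) :
  purification (\sum_i ketbra (w i) (w i)) (stack w).
Proof.
rewrite /purification; apply/matrixP => b c; rewrite !mxE summxE; apply: eq_bigr => i _.
by rewrite !mxE !big_ord1 !mxE !mxtens_indexK.
Qed.

Lemma psd_ketbra a (v : 'cV[C]_a) : psdmx (ketbra v v).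
Proof.
split=> [|w]; first by rewrite /ketbra adjmx_mul adjmxK.
have -> : adjmx w *m ketbra v v *m w = adjmx (adjmx v *m w) *m (adjmx v *m w).
  by rewrite /ketbra adjmx_mul adjmxK !mulmxA.
exact: adj_mul_ge0.
Qed.

Lemma psd_gram m n (Z : 'M[C]_(m, n)) : psdmx (Z *m adjmx Z).
Proof.
split=> [|w]; first by rewrite adjmx_mul adjmxK.
have -> : adjmx w *m (Z *m adjmx Z) *m w = adjmx (adjmx Z *m w) *m (adjmx Z *m w).
  by rewrite adjmx_mul adjmxK !mulmxA.
exact: adj_mul_ge0.
Qed.

Lemma psd_hermitian n (A : 'M[C]_n) : psdmx A -> hermitianmx A.
Proof. by case. Qed.

Lemma psd_conj m n (A : 'M[C]_n) (B : 'M[C]_(n, m)) : psdmx A -> psdmx (adjmx B *m A *m B).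
Proof.
move=> [hA pA]; split=> [|w]; first by rewrite hermitian_adj_mul.
by have := pA (B *m w); rewrite adjmx_mul !mulmxA.
Qed.

Lemma psd_diagonalize n (A : 'M[C]_n) : psdmx A ->
  exists P : 'M[C]_n, exists d : 'rV[C]_n,
    [/\ P \is unitarymx, A = adjmx P *m diag_mx d *m P & forall i, 0 <= d 0 i].
Proof.
move=> [hA pA]; have /esym/hermitian_normal/orthomx_spectralP eA := hA.
have uP := spectral_unitarymx A; rewrite (invmx_unitary_adj uP) in eA.
exists (spectralmx A), (spectral_diag A); split => // i.
have := pA (adjmx (spectralmx A) *m delta_mx i 0).
rewrite adjmx_mul adjmxK {2}eA -!mulmxA (mulmxA _ (adjmx _)) (iffRL (unitary_adjP _)) //.
rewrite mul1mx (mulmxA _ (adjmx _)) (iffRL (unitary_adjP _)) // mul1mx adjmx_delta.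
by rewrite mulmxA -rowE -colE !mxE eqxx mulr1n.
Qed.

Lemma psd_factor n (A : 'M[C]_n) : psdmx A -> exists G : 'M[C]_n, A = G *m adjmx G.
Proof.
move=> /psd_diagonalize [P [d [uP eA d0]]].
exists (adjmx P *m diag_mx (map_mx sqrtC d)).
rewrite adjmx_mul adjmxK adjmx_diag !mulmxA -(mulmxA (adjmx P)) mulmx_diag eA.
congr (_ *m diag_mx _ *m _); apply/rowP => i; rewrite !mxE.
by rewrite conj_Creal ?ger0_real ?sqrtC_ge0 // -expr2 sqrtCK.
Qed.

(** Complete positivity with reference C^k makes the image of [ketbra (stack w) (stack w)] positive;
    the [G i] are the block rows of a factor of it. *)
Lemma cp_gram a b k (N : 'M[C]_a -> 'M[C]_b) (w : 'I_k -> 'cV[C]_a) :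
  linear N -> completely_positive N ->
  exists e, exists G : 'I_k -> 'M[C]_(b, e),
    forall i j, N (ketbra (w i) (w j)) = G i *m adjmx (G j).
Proof.
move=> lN cpN; have := cpN _ _ (psd_ketbra (stack w)); rewrite tens_map_stack //.
move=> /psd_factor [G eG]; exists (b * k)%N.
exists (fun i => \matrix_(r, c) G (mxtens_index (r, i)) c) => i j.
apply/matrixP => r s; have /matrixP /(_ (mxtens_index (r, i)) (mxtens_index (s, j))) := eG.
rewrite (block_entry (fun i j => N (ketbra (w i) (w j)))) => ->; by rewrite !mxE; apply: eq_bigr => t _; rewrite !mxE.
Qed.

Lemma cp_hermitian a b (N : 'M[C]_a -> 'M[C]_b) :
  linear N -> completely_positive N -> hermitian_preserving N.
Proof.
move=> lN cpN X; have [e [G eG]] := cp_gram (fun i : 'I_a => delta_mx i 0) lN cpN.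
have eN i j : N (delta_mx i j) = G i *m adjmx (G j).
  by rewrite -eG /ketbra adjmx_delta mul_delta_mx.
rewrite (linear_mx_delta _ lN) (linear_mx_delta X lN) adjmx_sum exchange_big /=.
apply: eq_bigr => i _; rewrite adjmx_sum; apply: eq_bigr => j _.
by rewrite adjmxZ adjmxE !eN adjmx_mul adjmxK.
Qed.

Definition choi a b (T : 'M[C]_a -> 'M[C]_b) : 'M[C]_(b * a) :=
  \sum_i \sum_j (T (delta_mx i j) *t delta_mx i j).

Definition unstack a r (psi : 'cV[C]_(a * r)) : 'M[C]_(a, r) :=
  \matrix_(i, k) psi (mxtens_index (i, k)) 0.

(** The factorization isolates the purification in L, so that after a cyclic exchange only
    [adjmx L *m L] enters, and this depends on the reduced state alone. *)
Lemma tens_map_ketbra a b r (T : 'M[C]_a -> 'M[C]_b) (psi : 'cV[C]_(a * r)) :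
  let L := (1%:M : 'M[C]_b) *t (unstack psi)^T in
  tens_map T id (ketbra psi psi) = L *m (choi T *m adjmx L).
Proof.
move=> L; rewrite mulmxA /choi mulmx_sumr mulmx_suml /tens_map; apply: eq_bigr => i _.
rewrite mulmx_sumr mulmx_suml; apply: eq_bigr => j _.
rewrite /L adjmx_tens !tensmx_mul adjmx1 mulmx1 mul1mx.
rewrite [_ *m delta_mx i j *m _]matrix_sum_delta tensmx_sumr; apply: eq_bigr => k _.
rewrite tensmx_sumr; apply: eq_bigr => l _; rewrite tensmx_scaler; congr (_ *: _).
have -> : (ketbra psi psi) (mxtens_index (i, k)) (mxtens_index (j, l)) =
    unstack psi i k * (unstack psi j l)^*.
  by rewrite !mxE big_ord1 !mxE.
rewrite [RHS]mxE (bigD1 j) //= [X in _ + X]big1 ?addr0 => [|s /negPf h]; last first.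
  by rewrite mxE big1 ?mul0r // => t _; rewrite !mxE h andbF mulr0.
rewrite [X in _ = X * _]mxE (bigD1 i) //= [X in _ + X]big1 ?addr0 => [|s /negPf h]; last first.
  by rewrite !mxE h mulr0.
by rewrite adjmxE !mxE !eqxx mulr1.
Qed.

(** The value picked by [xget] is the one at [psi] because all values agree: [adjmx L *m L] is the
    identity tensored with the conjugate of [rho], for every purification, and [entropy_mulC]
    applies. *)
Lemma coherent_information_purification a b r (T : 'M[C]_a -> 'M[C]_b) rho
    (psi : 'cV[C]_(a * r)) :
  hermitian_preserving T -> purification rho psi ->
  coherent_information T rho =
  entropy (T rho) - entropy (tens_map T id (ketbra psi psi)).
Proof.
move=> hT ppsi; apply: xget_subset1; first by exists r, psi.
have adjLL s (phi : 'cV[C]_(a * s)) : purification rho phi ->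
    let L := (1%:M : 'M[C]_b) *t (unstack phi)^T in
    adjmx L *m L = 1%:M *t map_mx Num.conj rho.
  move=> pphi L; rewrite /L adjmx_tens tensmx_mul adjmx1 mulmx1; congr (_ *t _).
  rewrite -pphi; apply/matrixP => i j; rewrite !mxE rmorph_sum; apply: eq_bigr => k _.
  by rewrite !mxE big_ord1 !mxE rmorphM /= conjCK.
have hK s (phi : 'cV[C]_(a * s)) : hermitianmx (tens_map T id (ketbra phi phi)).
  by rewrite /hermitianmx -tens_map_hermitian // (psd_hermitian (psd_ketbra phi)).
move=> _ _ [s [phi [pphi ->]]] [s' [phi' [pphi' ->]]]; congr (_ - _).
have := hK _ phi; have := hK _ phi'; rewrite !tens_map_ketbra => h h'.
by apply: entropy_mulC => //; rewrite -!mulmxA !adjLL.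
Qed.

End TensorMaps.

(** * Polynomials on lines and Gauss decomposition *)

Section PolynomialsOnLines.
Variable R : realType.
Local Notation C := R[i].

(** One-variable polynomiality on every affine line is all that the extension arguments use, and it
    is stable under sums, products and multiplication of the argument by a fixed matrix. *)
Definition poly_on_lines d (f : 'M[C]_d -> C) :=
  forall A B, exists p : {poly C}, forall t, f (A + t *: B) = p.[t].

Lemma poly_on_lines_const d c : poly_on_lines (fun _ : 'M[C]_d => c).
Proof. by move=> A B; exists c%:P => t; rewrite hornerC. Qed.

Lemma poly_on_lines_entry d (i j : 'I_d) : poly_on_lines (fun X : 'M[C]_d => X i j).
Proof.
move=> A B; exists ((A i j)%:P + 'X * (B i j)%:P) => t.
by rewrite !hornerE !mxE.
Qed.

Lemma poly_on_lines_add d (f g : 'M[C]_d -> C) :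
  poly_on_lines f -> poly_on_lines g -> poly_on_lines (fun X => f X + g X).
Proof.
move=> hf hg A B; have [p hp] := hf A B; have [r hr] := hg A B.
by exists (p + r) => t; rewrite hornerD hp hr.
Qed.

Lemma poly_on_lines_mul d (f g : 'M[C]_d -> C) :
  poly_on_lines f -> poly_on_lines g -> poly_on_lines (fun X => f X * g X).
Proof.
move=> hf hg A B; have [p hp] := hf A B; have [r hr] := hg A B.
by exists (p * r) => t; rewrite hornerM hp hr.
Qed.

Lemma poly_on_lines_sum d I (r : seq I) (f : I -> 'M[C]_d -> C) :
  (forall i, poly_on_lines (f i)) -> poly_on_lines (fun X => \sum_(i <- r) f i X).
Proof.
move=> hf; elim: r => [|i r IHr] A B.
  by exists 0 => t; rewrite big_nil horner0.
have [p hp] := poly_on_lines_add (hf i) IHr A B.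
by exists p => t; rewrite big_cons hp.
Qed.

Lemma poly_on_lines_prod d I (r : seq I) (f : I -> 'M[C]_d -> C) :
  (forall i, poly_on_lines (f i)) -> poly_on_lines (fun X => \prod_(i <- r) f i X).
Proof.
move=> hf; elim: r => [|i r IHr] A B.
  by exists 1 => t; rewrite big_nil hornerC.
have [p hp] := poly_on_lines_mul (hf i) IHr A B.
by exists p => t; rewrite big_cons hp.
Qed.

Lemma poly_on_lines_exp d (f : 'M[C]_d -> C) n :
  poly_on_lines f -> poly_on_lines (fun X => f X ^+ n).
Proof.
by move=> hf A B; have [p hp] := hf A B; exists (p ^+ n) => t; rewrite horner_exp hp.
Qed.

Lemma poly_on_lines_mulr d (f : 'M[C]_d -> C) (Y : 'M[C]_d) :
  poly_on_lines f -> poly_on_lines (fun X => f (X *m Y)).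
Proof.
move=> hf A B; have [p hp] := hf (A *m Y) (B *m Y).
by exists p => t; rewrite mulmxDl -scalemxAl hp.
Qed.

Lemma poly_on_lines_mull d (f : 'M[C]_d -> C) (Y : 'M[C]_d) :
  poly_on_lines f -> poly_on_lines (fun X => f (Y *m X)).
Proof.
move=> hf A B; have [p hp] := hf (Y *m A) (Y *m B).
by exists p => t; rewrite mulmxDr -scalemxAr hp.
Qed.

Lemma polynomial_map_on_lines d D (q : 'M[C]_d -> 'M[C]_D) i j :
  polynomial_map q -> poly_on_lines (fun X => q X i j).
Proof.
move=> /(_ i j) [P hP] A B.
have h : poly_on_lines (fun X : 'M[C]_d => \sum_(m <- mpoly.msupp P)
    mpoly.mcoeff m P * \prod_i mxvec X ord0 i ^+ mpoly.fun_of_multinom m i).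
  apply: poly_on_lines_sum => m; apply: poly_on_lines_mul; first exact: poly_on_lines_const.
  apply: poly_on_lines_prod => s; apply: poly_on_lines_exp.
  case: (mxvec_indexP s) => k l A' B'; have [p hp] := poly_on_lines_entry k l A' B'.
  by exists p => t; rewrite mxvecE hp.
by have [p hp] := h A B; exists p => t; rewrite hP mpoly.mevalE hp.
Qed.

Lemma poly_inj_roots_eq0 (u : nat -> C) (p : {poly C}) :
  injective u -> (forall n, p.[u n] = 0) -> p = 0.
Proof.
move=> uI up; apply/eqP/negP => /negP p0.
have := @max_poly_roots _ p [seq u n | n <- iota 0 (size p)] p0.
rewrite size_map size_iota ltnn => h; have : false; last by [].
apply: h; last by rewrite map_inj_uniq ?iota_uniq.
by apply/allP => _ /mapP [n _ ->]; rewrite rootE up.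
Qed.

Lemma poly_off_roots_eq0 (p s : {poly C}) :
  s != 0 -> (forall t, s.[t] != 0 -> p.[t] = 0) -> p = 0.
Proof.
move=> s0 hp; suff /eqP : p * s = 0 by rewrite mulf_eq0 (negPf s0) orbF => /eqP.
apply: (@poly_inj_roots_eq0 (fun n => n%:R)) => [m n /eqP|n].
  by rewrite eqr_nat => /eqP.
rewrite hornerM; have [->|/hp->] := eqVneq s.[n%:R] 0; first by rewrite mulr0.
by rewrite mul0r.
Qed.

(** A nonzero polynomial in t off whose roots X + t is invertible. *)
Lemma horner_char_poly_opp d (X : 'M[C]_d) t : (char_poly (- X)).[t] = \det (X + t *: 1%:M).
Proof.
rewrite /char_poly -[LHS]/(horner_eval t _) -det_map_mx; congr (\det _).
apply/matrixP => i j; rewrite mxE -[LHS]/((char_poly_mx (- X) i j).[t]) !mxE.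
by rewrite hornerD hornerN hornerC hornerMn hornerX opprK addrC mulr_natr.
Qed.

(** Along t the function is a polynomial vanishing off the finitely many roots of [s], hence also at
    t = 0. *)
Lemma poly_on_lines_eq0 d (f : 'M[C]_d -> C) X (s : {poly C}) :
  poly_on_lines f -> s != 0 -> (forall t, s.[t] != 0 -> f (X + t *: 1%:M) = 0) -> f X = 0.
Proof.
move=> hf s0 h; have [p hp] := hf X 1%:M.
have p0 : p = 0 by apply: poly_off_roots_eq0 s0 _ => t /h; rewrite hp.
by have := hp 0; rewrite scale0r addr0 p0 horner0.
Qed.

(** Upper unitriangular; a lower one is described by its adjoint. *)
Definition unitriangular d (U : 'M[C]_d) :=
  (forall i, U i i = 1) /\ (forall i j : 'I_d, (j < i)%N -> U i j = 0).

(** Induction on the size by Schur complements. The polynomial [s] is the product of the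
    characteristic polynomials of the negated leading principal submatrices, so its value at t is
    the product of the leading principal minors of X + t. *)
Lemma gauss_decomposition d (X : 'M[C]_d) :
  exists2 s : {poly C}, s != 0 & forall t, s.[t] != 0 ->
    exists L, exists D : 'rV_d, exists U,
      [/\ unitriangular (adjmx L), unitriangular U, forall i, D 0 i != 0
        & X + t *: 1%:M = L *m diag_mx D *m U].
Proof.
elim: d X => [|d IHd].
  move=> X; exists 1; first exact: oner_neq0.
  move=> t _; exists 1%:M, 0, 1%:M; split=> [||[] //|]; try by split=> [[]|[]].
  by apply/matrixP => -[].
rewrite -addn1 => X; have [s s0 IH] := IHd (ulsubmx X).
have c0 := monic_neq0 (char_poly_monic (- X)).
exists (s * char_poly (- X)) => [|t]; first by rewrite mulf_neq0.
rewrite hornerM mulf_eq0 negb_or horner_char_poly_opp => /andP [/IH [L [D [U [hL hU hD eA]]]]].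
have -> : X + t *: 1%:M = block_mx (L *m diag_mx D *m U) (ursubmx X) (dlsubmx X) (drsubmx X + t *: 1%:M).
  rewrite -eA !scalemx1 -{1}[X]submxK (@scalar_mx_block _ d 1) add_block_mx.
  by congr block_mx; exact: addr0.
set b := ursubmx X; set c := dlsubmx X; set e := drsubmx X + _.
have uL : L \in unitmx.
  have h : is_trig_mx L.
    apply/is_trig_mxP => i j lt_ij; have := hL.2 j i lt_ij; rewrite adjmxE => /eqP.
    by rewrite conjC_eq0 => /eqP.
  rewrite unitmxE det_trig // big1 ?unitr1 // => i _; have := hL.1 i.
  by rewrite adjmxE => /eqP; rewrite fmorph_eq1 => /eqP.
have uD : diag_mx D \in unitmx.
  by rewrite unitmxE det_diag unitfE; apply/prodf_neq0 => i _.
have uU : U \in unitmx.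
  have h : is_trig_mx U^T.
    by apply/is_trig_mxP => i j lt_ij; rewrite mxE hU.2.
  by rewrite unitmxE -det_tr det_trig // big1 ?unitr1 // => i _; rewrite mxE hU.1.
(* [y] and [z] solve for the last column and row; [r] is the Schur complement, nonzero because the
   whole determinant is. *)
pose y := invmx (diag_mx D) *m (invmx L *m b).
pose z := c *m invmx U *m invmx (diag_mx D).
pose r := e - z *m diag_mx D *m y.
have eX : block_mx (L *m diag_mx D *m U) b c e =
    block_mx L 0 z 1%:M *m block_mx (diag_mx D) 0 0 r *m block_mx U y 0 1%:M.
  rewrite !mulmx_block !(mulmx0, mul0mx, addr0, add0r, mulmx1, mul1mx); congr block_mx.
  - by rewrite /y -mulmxA mulKVmx // mulKVmx.
  - by rewrite /z mulmxKV // mulmxKV.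
  - by rewrite /r addrC subrK.
rewrite eX; set Lt := block_mx L _ _ _; set Dt := block_mx _ 0 0 r; set Ut := block_mx U _ _ _.
rewrite !det_mulmx => /[dup] hd _.
have r0 : r 0 0 != 0.
  apply: contra hd => /eqP h; rewrite /Dt det_ublock [\det r]det_mx11 h.
  by rewrite !(mulr0, mul0r).
exists Lt, (row_mx D r), Ut; split.
- split=> [i|i j]; rewrite adjmxE.
    case: (split_ordP i) => k ->; rewrite ?block_mxEul ?block_mxEdr -?adjmxE; first exact: hL.1.
    by rewrite adjmx1 mxE eqxx.
  case: (split_ordP i) => k ->; case: (split_ordP j) => l -> /=.
  + by move=> lt; rewrite block_mxEul -adjmxE hL.2.
  + by move=> lt; have := leq_trans lt (ltnW (ltn_ord k)); rewrite ltnNge leq_addr.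
  + by move=> _; rewrite block_mxEur mxE conjC0.
  + by rewrite !ord1 ltnn.
- split=> [i|i j].
    case: (split_ordP i) => k ->; rewrite ?block_mxEul ?block_mxEdr; first exact: hU.1.
    by rewrite mxE ord1.
  case: (split_ordP i) => k ->; case: (split_ordP j) => l -> /=.
  + by move=> lt; rewrite block_mxEul hU.2.
  + by move=> lt; have := leq_trans lt (ltnW (ltn_ord k)); rewrite ltnNge leq_addr.
  + by move=> _; rewrite block_mxEdl mxE.
  + by rewrite !ord1 ltnn.
- move=> i; case: (split_ordP i) => k ->; first by rewrite row_mxEl.
  by rewrite row_mxEr (ord1 k); exact: r0.
- rewrite diag_mx_row; congr (_ *m _ *m _); congr block_mx.
  by apply/matrixP => i j; rewrite !ord1 !mxE.
Qed.

End PolynomialsOnLines.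

(** * Star representations and highest weight coefficients *)

Section StarRepresentations.
Variable R : realType.
Local Notation C := R[i].

(** The common interface of the [q lam] and of the tensor power: multiplicativity and compatibility
    with adjoints hold on all matrices, singular ones included. *)
Record star_representation d D (q : 'M[C]_d -> 'M[C]_D) : Prop := StarRepresentation {
  star_rep_poly : forall i j, poly_on_lines (fun X => q X i j);
  star_rep1 : q 1%:M = 1%:M;
  star_repM : forall X Y, q (X *m Y) = q X *m q Y;
  star_rep_adj : forall X, q (adjmx X) = adjmx (q X) }.

Lemma poly_rep_mul d D (q : 'M[C]_d -> 'M[C]_D) :
  polynomial_representation q -> forall X Y, q (X *m Y) = q X *m q Y.
Proof.
move=> [pq _ qM].
have hq i j := polynomial_map_on_lines i j pq.
have mul_lines Z i j : poly_on_lines (fun X => (q X *m q Z) i j).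
  move=> A B.
  have [p hp] : exists p : {poly C}, forall t, \sum_k q (A + t *: B) i k * q Z k j = p.[t].
    apply: (@poly_on_lines_sum _ _ _ _ (fun k X => q X i k * q Z k j)) => k.
    exact: (@poly_on_lines_mul _ _ (fun X => q X i k) (fun=> q Z k j) (hq i k) (poly_on_lines_const _)).
  by exists p => t; rewrite mxE hp.
have mul_lines' Z i j : poly_on_lines (fun X => (q Z *m q X) i j).
  move=> A B.
  have [p hp] : exists p : {poly C}, forall t, \sum_k q Z i k * q (A + t *: B) k j = p.[t].
    apply: (@poly_on_lines_sum _ _ _ _ (fun k X => q Z i k * q X k j)) => k.
    exact: (@poly_on_lines_mul _ _ (fun=> q Z i k) (fun X => q X k j) (poly_on_lines_const _) (hq k j)).
  by exists p => t; rewrite mxE hp.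
have ext (f g : 'M[C]_d -> C) : poly_on_lines f -> poly_on_lines g ->
    (forall X, X \in unitmx -> f X = g X) -> forall X, f X = g X.
  move=> hf hg e X; apply/eqP; rewrite -subr_eq0; apply/eqP.
  apply: (@poly_on_lines_eq0 _ _ (fun X => f X - g X) X (char_poly (- X))) => [||t].
  - move=> A B; have [p hp] := hf A B; have [r hr] := hg A B.
    by exists (p - r) => t; rewrite hp hr !hornerE.
  - exact: monic_neq0 (char_poly_monic _).
  - rewrite horner_char_poly_opp -unitfE => u.
    by rewrite e ?subrr // unitmxE.
(* The identity is extended from invertible to arbitrary matrices one factor at a time, with the
   other factor fixed. *)
have qMl X Y : Y \in unitmx -> q (X *m Y) = q X *m q Y.
  move=> uY; apply/matrixP => i j.
  apply: (ext (fun X => q (X *m Y) i j) (fun X => (q X *m q Y) i j)) => // [|{}X uX].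
    exact: (@poly_on_lines_mulr _ _ (fun X => q X i j)).
  by rewrite qM.
move=> X Y; apply/matrixP => i j.
apply: (ext (fun Y => q (X *m Y) i j) (fun Y => (q X *m q Y) i j)) => // [|{}Y uY].
  exact: (@poly_on_lines_mull _ _ (fun X => q X i j)).
by rewrite qMl.
Qed.

(** The Cayley transform (n + i) / (n - i), written so that injectivity is visible: an infinite
    supply of explicit points of the unit circle. *)
Definition circle_point (n : nat) : C := 1 + 2 * 'i / (n%:R - 'i).

Lemma natr_sub_i_neq0 (n : nat) : n%:R - 'i != 0 :> C.
Proof.
rewrite subr_eq0; apply/eqP => e; have := congr1 (fun z : C => z ^+ 2) e.
rewrite sqrCi => h; have : (0 : C) <= n%:R ^+ 2 by rewrite exprn_ge0 ?ler0n.
by rewrite h oppr_ge0 ler10.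
Qed.

Lemma circle_point_inj : injective circle_point.
Proof.
move=> m n /addrI /mulfI; have i0 : 2 * 'i != 0 :> C by rewrite mulf_neq0 ?pnatr_eq0 ?neq0Ci.
by move=> /(_ i0) /invr_inj /addIr /eqP; rewrite eqr_nat => /eqP.
Qed.

Lemma circle_point_norm n : circle_point n * (circle_point n)^* = 1.
Proof.
have e : circle_point n = (n%:R + 'i) / (n%:R - 'i).
  rewrite /circle_point -{1}(divff (natr_sub_i_neq0 n)) -mulrDl; congr (_ / _).
  by ring.
rewrite e rmorphM fmorphV rmorphD rmorphB /= conjCi conjC_nat opprK.
have n1 := natr_sub_i_neq0 n.
have n2 : n%:R + 'i != 0 :> C.
  apply: contra n1 => /eqP h; have := congr1 (fun z : C => z^*) h.
  by rewrite rmorphD /= conjCi conjC_nat rmorph0 => ->.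
by field; rewrite ?n1 ?n2.
Qed.

(* Compatibility with adjoints extends from unitary matrices to diagonal ones, one
   entry at a time, since the unit circle is infinite; then to Hermitian ones by
   the spectral theorem, and to [H + 'i K] by interpolation along [H + t K]. *)
Lemma weyl_star_representation d D (q : 'M[C]_d -> 'M[C]_D) :
  polynomial_representation q -> unitary_on_unitaries q -> star_representation q.
Proof.
move=> rq uq; have qM := poly_rep_mul rq; case: rq => [pq q1 _].
have hq i j := polynomial_map_on_lines i j pq.
pose S X := q (adjmx X) = adjmx (q X).
have SM X Y : S X -> S Y -> S (X *m Y).
  by rewrite /S adjmx_mul !qM adjmx_mul => -> ->.
have SU U : U \is unitarymx -> S U.
  move=> uU; have e := unitary_adj_mul (uq _ uU).
  by rewrite /S -[RHS]mulmx1 -q1 -(iffRL (unitary_adjP U) uU) qM mulmxA e mul1mx.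
pose Dl (l : 'I_d) (t : C) : 'M[C]_d := diag_mx (\row_i (if i == l then t else 1)).
have adjDl l t : adjmx (Dl l t) = Dl l t^*.
  rewrite adjmx_diag; congr diag_mx; apply/rowP => i; rewrite !mxE.
  by case: eqP => // _; rewrite rmorph1.
have SDl l t : S (Dl l t).
  rewrite /S adjDl; apply/matrixP => i j; rewrite adjmxE.
  have DlE s : Dl l s = Dl l 0 + s *: delta_mx l l.
    apply/matrixP => a b; rewrite !mxE; have [->|] := eqVneq a b; last first.
      move=> ab; rewrite !mulr0n add0r; have [al|] := eqVneq a l; last by rewrite mulr0.
      by have [bl|] := eqVneq b l; rewrite ?mulr0 // al bl eqxx in ab *.
    by rewrite andbb !mulr1n; case: eqP => _; rewrite ?mulr1 ?mulr0 ?addr0 ?add0r.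
  have [p hp] := hq i j (Dl l 0) (delta_mx l l).
  have [r hr] := hq j i (Dl l 0) (delta_mx l l).
  suff e : p = map_poly Num.conj r by rewrite (DlE t) (DlE t^*) hp hr e horner_map.
  apply/eqP; rewrite -subr_eq0; apply/eqP.
  apply: (poly_inj_roots_eq0 circle_point_inj) => n; set s := circle_point n.
  rewrite hornerD hornerN -hp -[s in (map_poly _ _).[s]]conjCK horner_map -hr -(DlE s) -(DlE s^*).
  have uD : Dl l s \is unitarymx.
    apply/unitary_adjP; rewrite adjDl mulmx_diag -diag_const_mx; congr diag_mx.
    by apply/rowP => a; rewrite !mxE; case: eqP => _; rewrite ?mulr1 ?circle_point_norm.
  by rewrite -adjDl (SU _ uD) adjmxE /= conjCK subrr.
have Sdiag (t : 'rV[C]_d) : S (diag_mx t).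
  have -> : diag_mx t = \big[mulmx/1%:M]_l Dl l (t 0 l).
    have E (r : seq 'I_d) : \big[mulmx/1%:M]_(l <- r) Dl l (t 0 l) =
        diag_mx (\row_i \prod_(l <- r) (if i == l then t 0 l else 1)).
      elim: r => [|l r IHr].
        rewrite big_nil -diag_const_mx; congr diag_mx; apply/rowP => i.
        by rewrite !mxE big_nil.
      rewrite big_cons IHr mulmx_diag; congr diag_mx; apply/rowP => i.
      by rewrite !mxE big_cons.
    rewrite E; congr diag_mx; apply/rowP => i; rewrite mxE.
    by rewrite -big_mkcond (big_pred1 i) // => j; rewrite eq_sym.
  apply: big_ind => //; by rewrite /S adjmx1 q1 adjmx1.
have Sherm X : hermitianmx X -> S X.
  move=> /hermitian_normal /orthomx_spectralP ->.
  have u := spectral_unitarymx X; rewrite (invmx_unitary_adj u).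
  have u' : adjmx (spectralmx X) \is unitarymx by rewrite trmxC_unitary.
  exact: SM _ _ (SM _ _ (SU _ u') (Sdiag _)) (SU _ u).
split => // X.
pose H : 'M[C]_d := 2^-1 *: (X + adjmx X).
pose K : 'M[C]_d := (2^-1 * - 'i) *: (X - adjmx X).
have half : (2^-1)^* = 2^-1 :> C by rewrite fmorphV /= conjC_nat.
have hH : adjmx H = H by rewrite adjmxZ half adjmxD adjmxK addrC.
have hK : adjmx K = K.
  rewrite adjmxZ adjmxB adjmxK -opprB scalerN -scaleNr; congr (_ *: _).
  by rewrite rmorphM /= half rmorphN /= conjCi !mulrN opprK.
have eX : X = H + 'i *: K.
  rewrite scalerA mulrCA mulrN -expr2 sqrCi opprK mulr1 -scalerDr addrACA subrr addr0.
  by rewrite -[X + X]mulr2n -[X *+ 2]scaler_nat scalerA mulVf ?pnatr_eq0 // scale1r.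
clearbody H K.
have eX' : adjmx X = H + (- 'i) *: K.
  rewrite eX adjmxD hH adjmxZ hK.
  congr (_ + _ *: _).
  exact: conjCi.
apply/matrixP => i j; rewrite adjmxE.
have [p hp] := hq i j H K; have [r hr] := hq j i H K.
suff e : p = map_poly Num.conj r.
  by rewrite eX' eX hp hr e -horner_map /= conjCi.
apply/eqP; rewrite -subr_eq0; apply/eqP.
apply: (@poly_inj_roots_eq0 _ (fun n => n%:R)) => [m n /eqP|n].
  by rewrite eqr_nat => /eqP.
have : S (H + n%:R *: K) by apply: Sherm; rewrite /hermitianmx adjmxD hH adjmxZ hK conjC_nat.
rewrite /S adjmxD hH adjmxZ hK conjC_nat => /matrixP /(_ i j); rewrite adjmxE hp hr.
by rewrite hornerD hornerN => ->; rewrite -horner_map /= conjC_nat subrr.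
Qed.

Definition fixed_by_unitriangular d D (q : 'M[C]_d -> 'M[C]_D) (v : 'cV[C]_D) :=
  forall U, unitriangular U -> q U *m v = v.

(** The zero vector is allowed, so that these vectors form a subspace. *)
Definition highest_weight_vector d D (q : 'M[C]_d -> 'M[C]_D) (mu : 'I_d -> nat)
    (v : 'cV[C]_D) :=
  (forall t : 'rV[C]_d, (forall i, t 0 i != 0) ->
     q (diag_mx t) *m v = (\prod_i t 0 i ^+ mu i) *: v) /\
  fixed_by_unitriangular q v.

(* By Gauss decomposition, both matrix coefficients are multiples of the same
   product of powers of leading principal minors of [X]. *)
Lemma highest_weight_coefficient d D D' (q : 'M[C]_d -> 'M[C]_D)
    (q' : 'M[C]_d -> 'M[C]_D') mu v w v' w' :
  star_representation q -> star_representation q' ->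
  fixed_by_unitriangular q v -> fixed_by_unitriangular q' v' ->
  highest_weight_vector q mu w -> highest_weight_vector q' mu w' ->
  forall X, (adjmx v' *m w') 0 0 * (adjmx v *m q X *m w) 0 0 =
            (adjmx v *m w) 0 0 * (adjmx v' *m q' X *m w') 0 0.
Proof.
move=> sq sq' fv fv' hw hw' X.
(* [p U] fixes b, and the adjoint of [p L] fixes a since [adjmx L] is upper unitriangular; only the
   diagonal factor is left. *)
have coef E (p : 'M[C]_d -> 'M[C]_E) a b : star_representation p ->
    fixed_by_unitriangular p a -> highest_weight_vector p mu b ->
    forall L (t : 'rV[C]_d) U, unitriangular (adjmx L) -> unitriangular U ->
      (forall i, t 0 i != 0) ->
      (adjmx a *m p (L *m diag_mx t *m U) *m b) 0 0 =
      (\prod_i t 0 i ^+ mu i) * (adjmx a *m b) 0 0.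
  move=> sp fa [wb fb] L t U hL hU t0; rewrite !(star_repM sp) -mulmxA -[_ *m p U *m b]mulmxA.
  rewrite fb // -mulmxA wb // -!scalemxAr mxE; congr (_ * _).
  by rewrite mulmxA -{1}[p L]adjmxK -(star_rep_adj sp) -adjmx_mul fa.
have lines E (p : 'M[C]_d -> 'M[C]_E) (a b : 'cV[C]_E) c : star_representation p ->
    poly_on_lines (fun X => c * (adjmx a *m p X *m b) 0 0).
  move=> sp A B.
  have [r hr] : exists r : {poly C}, forall t,
      c * \sum_j (\sum_i adjmx a 0 i * p (A + t *: B) i j) * b j 0 = r.[t].
    apply: (@poly_on_lines_mul _ _ (fun=> c) (fun X => \sum_j (\sum_i adjmx a 0 i * p X i j) * b j 0)).
      exact: poly_on_lines_const.
    apply: poly_on_lines_sum => j; apply: (@poly_on_lines_mul _ _ _ (fun=> b j 0)).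
      apply: poly_on_lines_sum => i; apply: (@poly_on_lines_mul _ _ (fun=> adjmx a 0 i)).
        exact: poly_on_lines_const.
      exact: (star_rep_poly sp).
    exact: poly_on_lines_const.
  exists r => t; rewrite -hr; congr (_ * _); rewrite mxE; apply: eq_bigr => j _.
  by rewrite mxE.
apply/eqP; rewrite -subr_eq0; apply/eqP.
have [s s0 hs] := gauss_decomposition X.
apply: (@poly_on_lines_eq0 _ _ (fun X => (adjmx v' *m w') 0 0 * (adjmx v *m q X *m w) 0 0 -
    (adjmx v *m w) 0 0 * (adjmx v' *m q' X *m w') 0 0) X s) => // [A B|t /hs].
  have [p hp] := lines _ q v w ((adjmx v' *m w') 0 0) sq A B.
  have [r hr] := lines _ q' v' w' ((adjmx v *m w) 0 0) sq' A B.
  by exists (p - r) => t; rewrite hp hr !hornerE.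
move=> [L [T [U [hL hU hT ->]]]].
rewrite (coef _ _ _ _ sq) // (coef _ _ _ _ sq') //.
by apply/eqP; rewrite subr_eq0; apply/eqP; ring.
Qed.

End StarRepresentations.

(** * Tensor powers and polarization *)

Section TensorPower.
Variable R : realType.
Local Notation C := R[i].

Local Notation word n d := {ffun 'I_n -> 'I_d}.

Definition word_of n d (i : 'I_#|{: word n d}|) : word n d := enum_val i.

Lemma word_of_rank n d (w : word n d) : word_of (enum_rank w) = w.
Proof. exact: enum_rankK. Qed.

Lemma rank_word_of n d (i : 'I_#|{: word n d}|) : enum_rank (word_of i) = i.
Proof. exact: enum_valK. Qed.

Lemma word_of_inj n d : injective (@word_of n d).
Proof. exact: enum_val_inj. Qed.

Lemma sum_words n d (F : word n d -> C) :
  \sum_w F w = \sum_(i < #|{: word n d}|) F (word_of i).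
Proof. exact: big_enum_val. Qed.

(* [ntensmx] in the basis indexed by words, on which permutations act. *)
Definition tensor_power n d e (X : 'M[C]_(d, e)) : 'M[C]_(#|{: word n d}|, #|{: word n e}|) :=
  \matrix_(i, j) \prod_l X (word_of i l) (word_of j l).

Lemma tensor_power_mul n d e f (X : 'M[C]_(d, e)) (Y : 'M[C]_(e, f)) :
  tensor_power n (X *m Y) = tensor_power n X *m tensor_power n Y.
Proof.
apply/matrixP => i j; rewrite !mxE.
transitivity (\prod_l \sum_k X (word_of i l) k * Y k (word_of j l)).
  by apply: eq_bigr => l _; rewrite mxE.
rewrite bigA_distr_bigA sum_words; apply: eq_bigr => k _.
by rewrite !mxE -big_split.
Qed.

Lemma prod_eq_words n d (w w' : word n d) :
  \prod_l (1%:M : 'M[C]_d) (w l) (w' l) = (w == w')%:R.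
Proof.
have [->|ne] := eqVneq w w'; first by rewrite big1 // => l _; rewrite mxE eqxx.
have /existsP [l hl] : [exists l, w l != w' l].
  by apply: contraNT ne => /existsPn h; apply/eqP/ffunP => l; apply/eqP; rewrite -[_ == _]negbK h.
by rewrite (bigD1 l) //= mxE (negPf hl) mul0r.
Qed.

Lemma tensor_power1 n d : tensor_power n (1%:M : 'M[C]_d) = 1%:M.
Proof.
by apply/matrixP => i j; rewrite mxE prod_eq_words mxE (inj_eq (@word_of_inj n d)).
Qed.

Lemma adj_tensor_power n d e (X : 'M[C]_(d, e)) :
  adjmx (tensor_power n X) = tensor_power n (adjmx X).
Proof.
apply/matrixP => i j; rewrite !mxE rmorph_prod; apply: eq_bigr => l _.
by rewrite !mxE.
Qed.

Lemma tensor_power_star n d : star_representation (@tensor_power n d d).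
Proof.
split=> [i j A B||X Y|X].
- have [p hp] := @poly_on_lines_prod R d _ (index_enum 'I_n)
    (fun l X => X (word_of i l) (word_of j l)) (fun l => poly_on_lines_entry _ _) A B.
  by exists p => t; rewrite mxE hp.
- exact: tensor_power1.
- exact: tensor_power_mul.
- by rewrite adj_tensor_power.
Qed.

(** If A misses some m, toggling the membership of m is a sign-reversing involution on the supersets
    of A. *)
Lemma signed_supersets n (A : {set 'I_n}) :
  \sum_(S : {set 'I_n} | A \subset S) (-1) ^+ #|~: S| = (A == setT)%:R :> C.
Proof.
have [->|ne] := eqVneq A setT.
  rewrite (big_pred1 setT) => [|S]; last by rewrite subTset.
  by rewrite setCT cards0.
have [m hm] : exists m, m \notin A.
  apply/existsP; apply: contraNT ne => /existsPn h; rewrite -subTset.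
  by apply/subsetP => x _; rewrite -[_ \in _]negbK h.
pose f (S : {set 'I_n}) := if m \in S then S :\ m else m |: S.
have fK : involutive f.
  move=> S; rewrite /f; case mS: (m \in S); first by rewrite !inE eqxx /= setD1K.
  by rewrite !inE eqxx /= setU1K ?mS.
set s := \sum_(S | _) _; suff : s = - s.
  by move/eqP; rewrite -addr_eq0 -mulr2n mulrn_eq0 /= => /eqP.
rewrite {1}/s (reindex_inj (inv_inj fK)) /= -sumrN; apply: eq_big => [S|S _].
  rewrite /f; case: ifP; first by rewrite subsetD1 hm andbT.
  by move=> mS; rewrite -[LHS]andbT -{1}hm -subsetD1 setU1K ?mS.
rewrite /f; case mS: (m \in S).
  have -> : ~: (S :\ m) = m |: ~: S.
    by apply/setP => x; rewrite !inE; case: eqP => //= ->; rewrite mS.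
  by rewrite cardsU1 !inE mS /= exprS mulN1r.
have -> : ~: S = m |: ~: (m |: S).
  by apply/setP => x; rewrite !inE; case: eqP => //= ->; rewrite mS.
by rewrite cardsU1 !inE eqxx /= exprS mulN1r opprK.
Qed.

(** Ryser's formula for the permanent. Expanding the product on the right, a function f receives the
    signed count of the supersets of its image, which is 1 for permutations and 0 otherwise. Here it
    serves as a polarization identity. *)
Lemma ryser n (a : 'I_n -> 'I_n -> C) :
  \sum_(s : 'S_n) \prod_l a (s l) l =
  \sum_(S : {set 'I_n}) (-1) ^+ #|~: S| * \prod_l \sum_(m in S) a m l.
Proof.
under [RHS]eq_bigr do rewrite bigA_distr_big mulr_sumr big_mkcond.
rewrite exchange_big /=.
transitivity (\sum_(f : {ffun 'I_n -> 'I_n}) (injectiveb f)%:R * \prod_l a (f l) l).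
  rewrite [RHS](bigID (fun f : {ffun 'I_n -> 'I_n} => injectiveb f)) /= [X in _ + X]big1 ?addr0; last first.
    by move=> f /negPf ->; rewrite mul0r.
  rewrite (reindex_onto (fun s : 'S_n => pval s) (fun f => insubd (1%g : 'S_n) f)) /=.
    apply: eq_big => [s|s _]; first by rewrite (valP s) valKd eqxx.
    by rewrite (valP s) mul1r; apply: eq_bigr => l _; rewrite pvalE.
  by move=> f hf; rewrite insubdK.
apply: eq_bigr => f _.
pose A := [set f l | l : 'I_n].
have -> : injectiveb f = (A == setT).
  apply/injectiveP/eqP => [fI|eA].
    by apply/eqP; rewrite eqEcard subsetT cardsT card_imset ?leqnn.
  have /imset_injP fI : #|f @: 'I_n| == #|'I_n|.
    by rewrite -[f @: 'I_n]/A eA cardsT.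
  by move=> x y; apply: fI.
rewrite -signed_supersets mulr_suml big_mkcond; apply: eq_bigr => S _.
have -> : (f \in ffun_on (mem S)) = (A \subset S).
  apply/ffun_onP/subsetP => [h _ /imsetP [l _ ->]|h l]; first exact: h.
  by apply: h; apply: imset_f.
by [].
Qed.

Definition permute_word n d (w : word n d) (s : 'S_n) : word n d := [ffun l => w (s l)].

Lemma permute_wordK n d (s : 'S_n) : cancel (fun w : word n d => permute_word w s) (fun w => permute_word w s^-1%g).
Proof. by move=> w; apply/ffunP => l; rewrite !ffunE permKV. Qed.

Lemma permute_wordKV n d (s : 'S_n) : cancel (fun w : word n d => permute_word w s^-1%g) (fun w => permute_word w s).
Proof. by move=> w; apply/ffunP => l; rewrite !ffunE permK. Qed.

Definition permutation_invariant n d (Y : 'M[C]_#|{: word n d}|) :=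
  forall (s : 'S_n) w w',
    Y (enum_rank (permute_word w s)) (enum_rank (permute_word w' s)) =
    Y (enum_rank w) (enum_rank w').

(** Averaging over the symmetric group writes Y through symmetrized matrix units, whose entries are
    permanents. By [ryser] each is a signed sum, over sets S of positions, of the tensor powers of
    the sum of the one-site matrix units at positions in S; the factor 1/n! is that of the
    average. *)
Lemma permutation_invariant_span n d (Y : 'M[C]_#|{: word n d}|) :
  permutation_invariant Y ->
  exists I : finType, exists c : I -> C, exists X : I -> 'M[C]_d,
    Y = \sum_a c a *: tensor_power n (X a).
Proof.
move=> hY.
exists ((word n d * word n d) * {set 'I_n})%type.
exists (fun a : word n d * word n d * {set 'I_n} => n`!%:R^-1 * Y (enum_rank a.1.1) (enum_rank a.1.2) * (-1) ^+ #|~: a.2|).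
exists (fun a : word n d * word n d * {set 'I_n} => \sum_(m in a.2) delta_mx (a.1.1 m) (a.1.2 m)).
have n0 : n`!%:R != 0 :> C by rewrite pnatr_eq0 -lt0n fact_gt0.
apply/matrixP => i j; set u := word_of i; set u' := word_of j.
rewrite summxE -(pair_bigA _ (fun (a : word n d * word n d) S =>
  ((n`!%:R^-1 * Y (enum_rank a.1) (enum_rank a.2) * (-1) ^+ #|~: S|) *:
    tensor_power n (\sum_(m in S) delta_mx (a.1 m) (a.2 m))) i j)) /=.
transitivity (\sum_(a : word n d * word n d) n`!%:R^-1 * Y (enum_rank a.1) (enum_rank a.2) *
    \sum_(s : 'S_n) ((u == permute_word a.1 s) && (u' == permute_word a.2 s))%:R); last first.
  apply: eq_bigr => -[w w'] _ /=; transitivity (n`!%:R^-1 * Y (enum_rank w) (enum_rank w') *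
      \sum_(s : 'S_n) \prod_l ((u l == w (s l)) && (u' l == w' (s l)))%:R).
    congr (_ * _); apply: eq_bigr => s _.
    rewrite -mulnb natrM -!prod_eq_words -big_split; apply: eq_bigr => l _.
    by rewrite !mxE !ffunE /= -natrM mulnb.
  rewrite (ryser (fun m l => ((u l == w m) && (u' l == w' m))%:R)) mulr_sumr.
  apply: eq_bigr => S _; rewrite !mxE mulrA; congr (_ * _); apply: eq_bigr => l _.
  by rewrite summxE; apply: eq_bigr => m _; rewrite mxE.
under eq_bigr do rewrite mulr_sumr.
rewrite exchange_big /=.
transitivity (\sum_(s : 'S_n) n`!%:R^-1 * Y i j).
  by rewrite sumr_const -[#|_|]/#|{: 'S_n}| card_Sn -[RHS]mulr_natl mulrA divff ?mul1r.
apply: eq_bigr => s _.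
rewrite (bigD1 (permute_word u s^-1%g, permute_word u' s^-1%g)) //= !permute_wordKV !eqxx mulr1.
rewrite big1 ?addr0 => [|[w w'] /= ne].
  by rewrite -(hY s) !permute_wordKV /u /u' !rank_word_of.
case: andP => [[/eqP e /eqP e']|_]; last by rewrite mulr0.
by case/eqP: ne; rewrite e e' !permute_wordK.
Qed.

End TensorPower.

(** * Specht modules and highest weight vectors *)

Section Specht.
Variable R : realType.
Local Notation C := R[i].

Local Notation word n d := {ffun 'I_n -> 'I_d}.
Local Notation filling n d := {ffun 'I_n -> 'I_d * 'I_n}.

Definition word_vec n d (f : {ffun word n d -> C^o}) : 'cV[C]_#|{: word n d}| :=
  \col_i f (word_of i).

Definition boxes n d (lam : partition_of n d) : {set 'I_d * 'I_n} :=
  [set p : 'I_d * 'I_n | (p.2 < part lam p.1)%N].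

Lemma partP n d (lam : partition_of n d) :
  (forall i j : 'I_d, (i <= j)%N -> (part lam j <= part lam i)%N) /\
  (\sum_i part lam i = n)%N.
Proof.
have /andP [/forallP h /eqP e] := valP lam; split => // i j ij.
by have /forallP /(_ j) /implyP := h i; apply.
Qed.

Lemma sum_ltn_ord n m : (m <= n)%N -> (\sum_(c < n) (c < m) = m)%N.
Proof.
move=> mn; rewrite -[RHS]card_ord -sum1_card (big_ord_widen n (fun=> 1%N)) //.
by rewrite [RHS]big_mkcond; apply: eq_bigr => c _; case: ifP.
Qed.

Lemma card_boxes_row n d (lam : partition_of n d) i :
  #|[set p in boxes lam | p.1 == i]| = part lam i.
Proof.
have hn : (part lam i <= n)%N by rewrite -ltnS; exact: ltn_ord.
rewrite -[RHS](sum_ltn_ord hn) -sum1dep_card.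
transitivity (\sum_(a : 'I_d | a == i) \sum_(c : 'I_n | (c < part lam a)%N) 1)%N.
  by rewrite pair_big_dep; apply: eq_bigl => p; rewrite !inE andbC.
by rewrite big_pred1_eq big_mkcond; apply: eq_bigr => c _; case: ifP.
Qed.

Lemma card_boxes n d (lam : partition_of n d) : #|boxes lam| = n.
Proof.
rewrite -[RHS](partP lam).2 -sum1_card (partition_big fst predT) //=.
apply: eq_bigr => i _; rewrite -(card_boxes_row lam i) -sum1dep_card.
by apply: eq_bigl => p; rewrite !inE.
Qed.

Lemma tableau_exists n d (lam : partition_of n d) :
  exists T : filling n d, is_tableau lam T.
Proof.
pose f (l : 'I_n) := enum_val (cast_ord (esym (card_boxes lam)) l).
exists [ffun l => f l]; apply/andP; split.
  by apply/injectiveP => x y; rewrite !ffunE => /enum_val_inj /cast_ord_inj.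
by apply/forallP => l; rewrite ffunE; have := enum_valP (cast_ord (esym (card_boxes lam)) l); rewrite inE.
Qed.

Lemma tableau_inj n d (lam : partition_of n d) (T : filling n d) :
  is_tableau lam T -> injective T.
Proof. by case/andP => /injectiveP. Qed.

Lemma tableau_imset n d (lam : partition_of n d) (T : filling n d) :
  is_tableau lam T -> T @: 'I_n = boxes lam.
Proof.
move=> hT; apply/eqP; rewrite eqEcard card_imset ?card_ord ?card_boxes ?leqnn ?andbT; last exact: tableau_inj hT.
case/andP: hT => _ /forallP h; apply/fintype.subsetP => p /imsetP [l _ ->].
by rewrite inE h.
Qed.

(** The product over the columns of T of minors of X, with row indices the letters of [w] and column
    indices the rows of the boxes. *)
Definition column_sum n d (T : filling n d) (X : 'M[C]_d) (w : word n d) : C :=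
  \sum_(s : 'S_n | in_column_stabilizer T s) (-1) ^+ s * \prod_l X (w l) (T (s l)).1.

Lemma tensor_power_polytabloid n d (T : filling n d) (X : 'M[C]_d) :
  tensor_power n X *m word_vec (polytabloid R T) = \col_i column_sum T X (word_of i).
Proof.
apply/matrixP => i j; rewrite !mxE /column_sum.
under eq_bigr => k _ do rewrite !mxE ffunE mulr_sumr.
rewrite exchange_big /=; apply: eq_bigr => s _.
rewrite -(sum_words (fun w => (\prod_l X (word_of i l) (w l)) *
   ((-1) ^+ s * (w == tabloid [ffun l => T (s l)])%:R))).
rewrite (bigD1 (tabloid [ffun l => T (s l)])) //= [X in _ + X]big1 ?addr0 => [|w /negPf ->].
  by rewrite eqxx mulr1 mulrC; congr (_ * _); apply: eq_bigr => l _; rewrite !ffunE.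
by rewrite !mulr0.
Qed.

Lemma polytabloid_column_sum n d (T : filling n d) w :
  polytabloid R T w = column_sum T 1%:M w.
Proof.
rewrite ffunE; apply: eq_bigr => s _; congr (_ * _).
by rewrite -prod_eq_words; apply: eq_bigr => l _; rewrite !ffunE.
Qed.

(** One of the determinants has two equal rows: composing with their transposition reverses the
    sign. *)
Lemma column_sum_repeat n d (T : filling n d) (X : 'M[C]_d) (w : word n d) l1 l2 :
  l1 != l2 -> (T l1).2 = (T l2).2 -> w l1 = w l2 -> column_sum T X w = 0.
Proof.
move=> l12 eT ew; set t := tperm l1 l2.
have wt l : w (t l) = w l by rewrite /t; case: tpermP => [->|->|].
have Tt l : (T (t l)).2 = (T l).2 by rewrite /t; case: tpermP => [->|->|].
suff : column_sum T X w = - column_sum T X w.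
  by move/eqP; rewrite -addr_eq0 -mulr2n mulrn_eq0 /= => /eqP.
rewrite {1}/column_sum (reindex_inj (mulgI t)) /= -sumrN; apply: eq_big => [s|s _].
  apply/forallP/forallP => h l; last by rewrite permM (eqP (h _)) Tt.
  by have := h (t l); rewrite permM tpermK Tt.
rewrite odd_permM odd_tperm l12 /= signrN mulNr; congr (- (_ * _)).
rewrite (reindex_inj (@perm_inj _ t)); apply: eq_bigr => l _.
by rewrite permM tpermK wt.
Qed.

(** With a repeated letter in a column both sides vanish. Otherwise the sums agree term by term:
    either a letter exceeds the row of its box and both products contain a zero, or every letter is
    at most that row and distinctness in columns forces equality, so both products are 1. *)
Lemma column_sum_unitriangular n d (lam : partition_of n d) (T : filling n d) (U : 'M[C]_d) w :
  is_tableau lam T -> unitriangular U -> column_sum T U w = column_sum T 1%:M w.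
Proof.
move=> hT [U1 U0].
have [/existsP [[l1 l2] /and3P [/= l12 /eqP eT /eqP ew]]|] :=
  boolP [exists p : 'I_n * 'I_n, [&& p.1 != p.2, (T p.1).2 == (T p.2).2 & w p.1 == w p.2]].
  by rewrite !(column_sum_repeat _ l12 eT ew).
move=> /existsPn inj_w; apply: eq_bigr => s hs; congr (_ * _).
have [/existsP [l hl]|] := boolP [exists l, ((T (s l)).1 < w l)%N].
  rewrite (bigD1 l) //= U0 // mul0r (bigD1 l) //= mxE.
  by rewrite -val_eqE gtn_eqF ?mul0r.
move=> /existsPn le_w.
(* Induction on the row: a smaller letter would already be taken by a higher box of the same column,
   which exists because the row lengths decrease. *)
have eq_w m : forall l, ((T (s l)).1 < m)%N -> w l = (T (s l)).1.
  elim: m => [//|m IH] l; rewrite ltnS leq_eqVlt => /orP [/eqP em|]; last exact: IH.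
  apply/val_inj/eqP; rewrite /= eqn_leq.
  move: (le_w l); rewrite -leqNgt => -> /=; rewrite leqNgt; apply/negP => lt_w.
  (* The box of the same column in row [w l] has an entry [l'], and [w l' = w l] by induction. *)
  have : (w l, (T (s l)).2) \in T @: 'I_n.
    rewrite (tableau_imset hT) inE /=; apply: leq_trans ((partP lam).1 _ _ (ltnW lt_w)).
    by have /andP [_ /forallP] := hT; apply.
  move=> /imsetP [l0 _ el0].
  have eTs : T (s (s^-1%g l0)) = (w l, (T (s l)).2) by rewrite permKV el0.
  have w' : w (s^-1%g l0) = w l by rewrite IH eTs //= -em.
  have := inj_w (s^-1%g l0, l); rewrite /= w' eqxx andbT.
  have /forallP hs' := hs; rewrite -(eqP (hs' l)) -(eqP (hs' (s^-1%g l0))) eTs eqxx andbT negbK.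
  by move=> /eqP e; move: lt_w eTs; rewrite e => lt_w eTs; rewrite eTs ltnn in lt_w.
have wE l : w l = (T (s l)).1 by exact: eq_w (ltnSn _).
by rewrite !big1 // => l _; rewrite wE ?U1 // mxE eqxx.
Qed.

Lemma tableau_weight n d (lam : partition_of n d) (T : filling n d) (t : 'I_d -> C) :
  is_tableau lam T -> \prod_l t (T l).1 = \prod_i t i ^+ part lam i.
Proof.
move=> hT; rewrite (partition_big (fun l => (T l).1) predT) //=; apply: eq_bigr => i _.
rewrite (eq_bigr (fun=> t i)) => [|l /eqP -> //].
rewrite prodr_const -(card_boxes_row lam i); congr (_ ^+ _).
rewrite -(card_imset _ (tableau_inj hT)); apply: eq_card => p; rewrite [RHS]inE -(tableau_imset hT).
apply/imsetP/andP => [[l hl ->]|[/imsetP [l _ ->] hl]].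
  by split; [exact: imset_f | exact: hl].
by exists l.
Qed.

Lemma polytabloid_highest_weight n d (lam : partition_of n d) (T : filling n d) :
  is_tableau lam T ->
  highest_weight_vector (@tensor_power R n d d) (part lam) (word_vec (polytabloid R T)).
Proof.
move=> hT; split=> [t _|U hU]; rewrite tensor_power_polytabloid; apply/matrixP => i j; rewrite !mxE.
  rewrite polytabloid_column_sum mulr_sumr; apply: eq_bigr => s _; rewrite mulrCA; congr (_ * _).
  rewrite -(tableau_weight (t 0) hT) [X in X * _](reindex_inj (@perm_inj _ s)) -big_split /=.
  apply: eq_bigr => l _; rewrite !mxE; have [->|_] := eqVneq; last by rewrite mulr0n mulr0.
  by rewrite mulr1n mulr1.
by rewrite (column_sum_unitriangular _ hT hU) polytabloid_column_sum.
Qed.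

(** The coefficient at the tabloid of T itself is 1: a permutation preserving both rows and columns
    of all entries is trivial. *)
Lemma polytabloid_neq0 n d (lam : partition_of n d) (T : filling n d) :
  is_tableau lam T -> word_vec (polytabloid R T) != 0.
Proof.
move=> hT; apply/eqP => /matrixP /(_ (enum_rank (tabloid T)) 0); rewrite !mxE word_of_rank ffunE.
rewrite (bigD1 1%g) /=; last by apply/forallP => l; rewrite perm1.
rewrite odd_perm1 expr0 mul1r [X in _ + X]big1 ?addr0 => [|s /andP [/forallP hs s1]].
  have -> : tabloid T == tabloid [ffun l => T ((1%g : 'S_n) l)].
    by apply/eqP/ffunP => l; rewrite !ffunE perm1.
  by move/eqP; rewrite oner_eq0.
case: eqP => [/ffunP e|_]; last by rewrite mulr0.
case/eqP: s1; apply/permP => l; rewrite perm1; apply: (tableau_inj hT).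
have := e l; rewrite !ffunE => e1; have /eqP e2 := hs l.
by rewrite [T (s l)]surjective_pairing [T l]surjective_pairing -e1 e2.
Qed.

Lemma polytabloid_permute n d (T : filling n d) (s : 'S_n) w :
  polytabloid R T (permute_word w s) = polytabloid R [ffun l => T (s^-1%g l)] w.
Proof.
rewrite !ffunE (reindex_inj (conjg_inj s^-1%g)) /=; apply: eq_big => [u|u _].
  apply/forallP/forallP => h l.
    by have := h (s^-1%g l); rewrite !ffunE conjgE invgK !permM permKV.
  by have := h (s l); rewrite !ffunE conjgE invgK !permM permK.
rewrite odd_permJ; congr (_ * (_ : bool)%:R).
apply/eqP/eqP => /ffunP h; apply/ffunP => l.
  by have := h (s^-1%g l); rewrite !ffunE conjgE invgK !permM permKV.
by have := h (s l); rewrite !ffunE conjgE invgK !permM.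
Qed.


Definition word_fun n d (x : 'cV[C]_#|{: word n d}|) : {ffun word n d -> C^o} :=
  [ffun w => x (enum_rank w) 0].

Lemma word_funK n d (x : 'cV[C]_#|{: word n d}|) : word_vec (word_fun x) = x.
Proof. by apply/colP => i; rewrite !mxE ffunE rank_word_of. Qed.

Lemma word_vec_inj n d : injective (@word_vec n d).
Proof.
move=> f g /matrixP e; apply/ffunP => w.
by have := e (enum_rank w) 0; rewrite !mxE word_of_rank.
Qed.

Lemma word_vec_sum n d I (r : seq I) (c : I -> C) (f : I -> {ffun word n d -> C^o}) :
  word_vec (\sum_(i <- r) c i *: f i) = \sum_(i <- r) c i *: word_vec (f i).
Proof.
apply/colP => i; rewrite mxE sum_ffunE summxE; apply: eq_bigr => k _.
by rewrite ffunE !mxE.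
Qed.

(** Gram-Schmidt applied to the coordinates of a basis; the transposes translate between row spaces
    and column vectors, and [B *m adjmx B] is the orthogonal projector. *)
Lemma orthonormal_basis n d (S : {vspace {ffun word n d -> C^o}}) :
  exists B : 'M[C]_(#|{: word n d}|, \dim S),
    adjmx B *m B = 1%:M /\
    forall f, f \in S <-> B *m adjmx B *m word_vec f = word_vec f.
Proof.
pose X := vbasis S; have /andP [/eqP sX fX] : basis_of S X := vbasisP S.
pose V : 'M[C]_(\dim S, #|{: word n d}|) := \matrix_i (word_vec X`_i)^T.
have mulV (u : 'rV[C]_(\dim S)) : u *m V = (word_vec (\sum_(i < \dim S) u 0 i *: X`_i))^T.
  rewrite word_vec_sum raddf_sum mulmx_sum_row; apply: eq_bigr => i _.
  by rewrite rowK; apply/matrixP => a b; rewrite !mxE.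
have freeV : row_free V.
  apply: inj_row_free => u; rewrite mulV => /(congr1 trmx); rewrite trmxK trmx0 => h.
  have {}h : \sum_(i < \dim S) u 0 i *: X`_i = 0.
    by apply: word_vec_inj; rewrite h; apply/colP => i; rewrite !mxE ffunE.
  by apply/rowP => j; rewrite -(coord_sum_free (fun i => u 0 i) j fX) h linear0 mxE.
have memV f : f \in S <-> ((word_vec f)^T <= V)%MS.
  split=> [|/submxP [u]].
    move=> fS; have /coord_span -> : f \in <<X>>%VS by rewrite sX.
    apply/submxP.
    exists (\row_i coord X i f); rewrite mulV; congr (word_vec _)^T.
    by apply: eq_bigr => i _; rewrite mxE.
  rewrite mulV => /trmx_inj /word_vec_inj ->.
  apply: memv_suml => i _; apply: memvZ.
  have : X`_i \in <<X>>%VS by apply: memv_span; apply: mem_nth; rewrite size_tuple.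
  by rewrite sX.
have leN : (\dim S <= #|{: word n d}|)%N by rewrite -(eqP freeV) rank_leq_col.
have /unitary_adjP uS := schmidt_unitarymx V leN.
have eS := eqmx_schmidt_free freeV.
set Q := schmidt V in uS eS.
have adjT : adjmx Q^T = map_mx Num.conj Q by rewrite /adjmx trmxK.
exists Q^T; split.
  by rewrite adjT; have := congr1 trmx uS; rewrite trmx_mul trmx1 /adjmx -map_trmx trmxK.
move=> f; rewrite memV -eS adjT; split=> [/submxP [u e]|e].
  apply: trmx_inj; rewrite !trmx_mul trmxK e map_trmx -[map_mx _ _]/(adjmx Q).
  by rewrite -!mulmxA (mulmxA Q) uS mul1mx.
by rewrite -e !trmx_mul trmxK mulmxA submxMl.
Qed.

Lemma highest_weight_lincomb n d mu I (r : seq I) (c : I -> C)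
    (v : I -> 'cV[C]_#|{: word n d}|) :
  (forall i, highest_weight_vector (@tensor_power R n d d) mu (v i)) ->
  highest_weight_vector (@tensor_power R n d d) mu (\sum_(i <- r) c i *: v i).
Proof.
move=> hv; split=> [t t0|U hU]; rewrite mulmx_sumr ?scaler_sumr; apply: eq_bigr => i _.
  by rewrite -scalemxAr (hv i).1 // !scalerA mulrC.
by rewrite -scalemxAr (hv i).2.
Qed.

Lemma specht_span n d (lam : partition_of n d) f :
  f \in specht_module R lam ->
  exists m, exists c : 'I_m -> C, exists T : 'I_m -> filling n d,
    (forall i, is_tableau lam (T i)) /\ f = \sum_i c i *: polytabloid R (T i).
Proof.
rewrite /specht_module; set s := (X in <<X>>%VS); move=> /(@coord_span _ _ _ (in_tuple s)) => e.
have hT (i : 'I_(size s)) : exists T, is_tableau lam T && (s`_i == polytabloid R T).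
  have /mapP [T hT ->] := mem_nth 0 (ltn_ord i); exists T.
  by rewrite eqxx andbT; rewrite mem_enum in hT.
exists (size s), (fun i => coord (in_tuple s) i f), (fun i => xchoose (hT i)).
split=> [i|]; first by case/andP: (xchooseP (hT i)).
rewrite {1}e; apply: eq_bigr => i _; congr (_ *: _).
by case/andP: (xchooseP (hT i)) => _ /eqP <-.
Qed.

Lemma polytabloid_in_specht n d (lam : partition_of n d) (T : filling n d) :
  is_tableau lam T -> polytabloid R T \in specht_module R lam.
Proof. by move=> hT; apply: memv_span; apply: image_f. Qed.

Lemma specht_highest_weight n d (lam : partition_of n d) f :
  f \in specht_module R lam ->
  highest_weight_vector (@tensor_power R n d d) (part lam) (word_vec f).
Proof.
move=> /specht_span [m [c [T [hT ->]]]]; rewrite word_vec_sum.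
by apply: highest_weight_lincomb => i; exact: polytabloid_highest_weight.
Qed.

Lemma specht_permute n d (lam : partition_of n d) (s : 'S_n) f :
  f \in specht_module R lam -> [ffun w => f (permute_word w s)] \in specht_module R lam.
Proof.
move=> /specht_span [m [c [T [hT ->]]]].
have -> : [ffun w => (\sum_i c i *: polytabloid R (T i)) (permute_word w s)] =
    \sum_i c i *: polytabloid R [ffun l => T i (s^-1%g l)].
  apply/ffunP => w; rewrite ffunE !sum_ffunE; apply: eq_bigr => i _.
  by rewrite ffunE polytabloid_permute [RHS]ffunE.
apply: memv_suml => i _; apply: memvZ; apply: polytabloid_in_specht.
have /andP [/injectiveP Ti /forallP hTi] := hT i; apply/andP; split.
  by apply/injectiveP => x y; rewrite !ffunE => /Ti /perm_inj.
by apply/forallP => l; rewrite ffunE.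
Qed.

(** The permutation operators [M s] preserve the range of P, so P M P = M P; the adjoint of this
    relation for the inverse permutation gives P M P = P M. *)
Lemma specht_projector_invariant n d (lam : partition_of n d) p
    (B : 'M[C]_(#|{: word n d}|, p)) :
  adjmx B *m B = 1%:M ->
  (forall f, f \in specht_module R lam <-> B *m adjmx B *m word_vec f = word_vec f) ->
  permutation_invariant (B *m adjmx B).
Proof.
move=> BB hB; set P := B *m adjmx B.
have PP : P *m P = P by rewrite /P -mulmxA (mulmxA (adjmx B)) BB mul1mx.
have hP : adjmx P = P by rewrite /P adjmx_mul adjmxK.
pose M (s : 'S_n) : 'M[C]_#|{: word n d}| :=
  \matrix_(i, j) (word_of j == permute_word (word_of i) s)%:R.
have ME s (x : 'cV_#|{: word n d}|) : M s *m x = word_vec [ffun w => word_fun x (permute_word w s)].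
  apply/colP => i; rewrite !mxE !ffunE (bigD1 (enum_rank (permute_word (word_of i) s))) //=.
  rewrite mxE word_of_rank eqxx mul1r [X in _ + X]big1 ?addr0 // => j ne.
  rewrite mxE; case: eqP => [e|_]; last by rewrite mul0r.
  by rewrite -e rank_word_of eqxx in ne.
have PMP s : P *m M s *m P = M s *m P.
  apply/matrixP => i j.
  suff e : P *m (M s *m (P *m delta_mx j 0)) = M s *m (P *m delta_mx j (0 : 'I_1)).
    by have /colP /(_ i) := e; rewrite !mulmxA -!colE !mxE.
  rewrite ME; apply/hB/specht_permute/hB; rewrite word_funK mulmxA.
  by rewrite -[B *m _ *m (B *m _)]/(P *m P) PP.
have adjM s : adjmx (M s) = M s^-1%g.
  apply/matrixP => i j; rewrite !mxE conjC_nat; congr (_ : bool)%:R.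
  by apply/eqP/eqP => ->; rewrite ?permute_wordK ?permute_wordKV.
have PM s : P *m M s = M s *m P.
  rewrite -[RHS]PMP -[LHS]adjmxK (adjmx_mul P) hP adjM -PMP.
  by rewrite (adjmx_mul (P *m _)) (adjmx_mul P) hP adjM invgK mulmxA.
move=> s w w'; have /matrixP /(_ (enum_rank w) (enum_rank (permute_word w' s))) := PM s.
have -> : (P *m M s) (enum_rank w) (enum_rank (permute_word w' s)) = P (enum_rank w) (enum_rank w').
  rewrite mxE (bigD1 (enum_rank w')) //= [M s _ _]mxE !word_of_rank eqxx mulr1.
  rewrite [X in _ + X]big1 ?addr0 // => j ne.
  rewrite [M s _ _]mxE word_of_rank; case: eqP => [e|_]; last by rewrite mulr0.
  by case/eqP: ne; rewrite -[w'](permute_wordK s) e permute_wordK rank_word_of.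
have -> // : (M s *m P) (enum_rank w) (enum_rank (permute_word w' s)) =
    P (enum_rank (permute_word w s)) (enum_rank (permute_word w' s)).
rewrite mxE (bigD1 (enum_rank (permute_word w s))) //= [M s _ _]mxE !word_of_rank eqxx mul1r.
rewrite [X in _ + X]big1 ?addr0 // => j ne.
rewrite [M s _ _]mxE word_of_rank; case: eqP => [e|_]; last by rewrite mul0r.
by rewrite -e rank_word_of eqxx in ne.
Qed.

(* The projector onto the Specht module is a combination of tensor powers, whose
   diagonal coefficients at unit highest weight vectors only depend on [lam]. *)
Lemma highest_weight_in_specht n d (lam : partition_of n d) p
    (B : 'M[C]_(#|{: word n d}|, p)) v :
  adjmx B *m B = 1%:M ->
  (forall f, f \in specht_module R lam <-> B *m adjmx B *m word_vec f = word_vec f) ->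
  highest_weight_vector (@tensor_power R n d d) (part lam) v ->
  B *m adjmx B *m v = v.
Proof.
move=> BB hB hv; have [I [c [X eP]]] := permutation_invariant_span (specht_projector_invariant BB hB).
set P := B *m adjmx B in eP *.
have PP : P *m P = P by rewrite /P -mulmxA (mulmxA (adjmx B)) BB mul1mx.
have hP : adjmx P = P by rewrite /P adjmx_mul adjmxK.
have [T hT] := tableau_exists lam; pose e := word_vec (polytabloid R T).
have he : highest_weight_vector (@tensor_power R n d d) (part lam) e := polytabloid_highest_weight hT.
have Pe : P *m e = e by apply/hB; exact: polytabloid_in_specht.
have st := tensor_power_star R n d.
have coef (a : 'cV_#|{: word n d}|) : (adjmx a *m P *m a) 0 0 =
    \sum_i c i * (adjmx a *m tensor_power n (X i) *m a) 0 0.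
  rewrite eP mulmx_sumr mulmx_suml summxE; apply: eq_bigr => i _.
  by rewrite -scalemxAr -scalemxAl mxE.
have key : (adjmx e *m e) 0 0 * (adjmx v *m P *m v) 0 0 =
           (adjmx v *m v) 0 0 * (adjmx e *m P *m e) 0 0.
  rewrite !coef !mulr_sumr; apply: eq_bigr => i _; rewrite !(mulrCA _ (c i)); congr (_ * _).
  exact: (highest_weight_coefficient st st hv.2 he.2 hv he).
have e0 : (adjmx e *m e) 0 0 != 0 by rewrite gt_eqF // adj_mul_gt0 // (polytabloid_neq0 hT).
have {}key : (adjmx v *m P *m v) 0 0 = (adjmx v *m v) 0 0.
  by apply: (mulfI e0); rewrite key -(mulmxA _ P) Pe mulrC.
(* For an orthogonal projector, the squared norm of v - P v is <v, v> - <v, P v>, which is 0 by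
   [key]. *)
apply/esym/eqP; rewrite -subr_eq0; apply/eqP/adj_mul_eq0; clearbody P.
rewrite adjmxB (adjmx_mul P v) hP mulmxBl -(mulmxA _ P) (mulmxBr P) (mulmxA P P) PP.
rewrite subrr mulmx0 subr0 mulmxBr mulmxA.
by apply/matrixP => i j; rewrite !ord1 mxE [X in _ + X]mxE key subrr mxE.
Qed.

End Specht.

(** * Existence of highest weight vectors *)

Section HighestWeightExists.
Variable R : realType.
Local Notation C := R[i].

Local Notation word n d := {ffun 'I_n -> 'I_d}.

Definition content n d (w : word n d) : {ffun 'I_d -> nat} := [ffun i => #|[set l | w l == i]|].

Lemma prod_content n d (w : word n d) (t : 'I_d -> C) :
  \prod_l t (w l) = \prod_i t i ^+ content w i.
Proof.
rewrite (partition_big w predT) //=; apply: eq_bigr => i _.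
rewrite ffunE -prodr_const; apply: eq_big => [l|l /eqP -> //].
by rewrite inE.
Qed.

Lemma sum_content n d (w : word n d) (f : 'I_d -> nat) :
  (\sum_l f (w l) = \sum_i content w i * f i)%N.
Proof.
rewrite (partition_big w predT) //=; apply: eq_bigr => i _.
rewrite ffunE -sum_nat_const; apply: eq_big => [l|l /eqP -> //].
by rewrite inE.
Qed.

Lemma tensor_power_diag n d (t : 'rV[C]_d) :
  tensor_power n (diag_mx t) = diag_mx (\row_j \prod_i t 0 i ^+ content (word_of j) i).
Proof.
apply/matrixP => i j; rewrite !mxE -prod_content.
transitivity (\prod_l (t 0 (word_of i l) * (1%:M : 'M[C]_d) (word_of i l) (word_of j l))).
  by apply: eq_bigr => l _; rewrite !mxE mulr_natr.
rewrite big_split prod_eq_words /= (inj_eq (@word_of_inj n d)) mulr_natr.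
by have [->|_] := eqVneq i j; rewrite ?mulr0n.
Qed.

(** The diagonal matrix with a single entry 2, at place a, scales a word by 2 to the power of its
    content at a; P can only link words with equal eigenvalue. *)
Lemma content_commute n d (P : 'M[C]_#|{: word n d}|) i j :
  (forall X : 'M[C]_d, P *m tensor_power n X = tensor_power n X *m P) ->
  P i j != 0 -> content (word_of i) = content (word_of j).
Proof.
move=> hP Pij; apply/ffunP => a.
pose t : 'rV[C]_d := \row_b (if b == a then 2 else 1).
have tE (w : word n d) : \prod_b t 0 b ^+ content w b = 2 ^+ content w a.
  rewrite (bigD1 a) //= mxE eqxx big1 ?mulr1 // => b /negPf h.
  by rewrite mxE h expr1n.
have := hP (diag_mx t); rewrite tensor_power_diag mul_mx_diag mul_diag_mx => /matrixP /(_ i j).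
rewrite !mxE !tE [RHS]mulrC => /(mulfI Pij) /eqP.
by rewrite -!natrX eqr_nat eqn_exp2l // => /eqP.
Qed.

Lemma tensor_power_unitriangular n d (U : 'M[C]_d) (w w' : word n d) :
  unitriangular U -> tensor_power n U (enum_rank w') (enum_rank w) != 0 ->
  w' = w \/ (\sum_l w' l < \sum_l w l)%N.
Proof.
move=> [U1 U0]; rewrite mxE !word_of_rank => /prodf_neq0 h.
have le l : (w' l <= w l)%N.
  by rewrite leqNgt; apply/negP => lt; have := h l isT; rewrite U0 ?eqxx.
have [->|ne] := eqVneq w' w; [by left | right].
have [l hl] : exists l, w' l != w l.
  apply/existsP; apply: contraNT ne => /existsPn e; apply/eqP/ffunP => l.
  by apply/eqP; rewrite -[_ == _]negbK e.
rewrite (bigD1 l) //= [X in (_ < X)%N](bigD1 l) //= -addSn leq_add //.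
  by rewrite ltn_neqAle le andbT.
by apply: leq_sum => k _.
Qed.

(* Commuting with the images of diagonal matrices, [P] preserves weight spaces. *)
Lemma kernel_weight_component n d (P : 'M[C]_#|{: word n d}|)
    (y : 'cV[C]_#|{: word n d}|) w :
  (forall X : 'M[C]_d, P *m tensor_power n X = tensor_power n X *m P) ->
  P *m y = 0 -> y (enum_rank w) 0 != 0 ->
  exists v : 'cV[C]_#|{: word n d}|,
    [/\ v != 0, P *m v = 0 & forall w', v (enum_rank w') 0 != 0 -> content w' = content w].
Proof.
move=> hP Py yw; exists (\col_i (if content (word_of i) == content w then y i 0 else 0)).
split.
- by apply: contraNneq yw => /colP /(_ (enum_rank w)); rewrite !mxE word_of_rank eqxx => ->.
- apply/colP => i; rewrite !mxE.
  have [e|ne] := eqVneq (content (word_of i)) (content w).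
    have /colP /(_ i) := Py; rewrite !mxE => Pyi; rewrite -[RHS]Pyi; apply: eq_bigr => j _; rewrite mxE.
    have [->|/(content_commute hP) e'] := eqVneq (P i j) 0; first by rewrite !mul0r.
    by rewrite -e' e eqxx.
  rewrite big1 // => j _; rewrite mxE.
  have [->|/(content_commute hP) e'] := eqVneq (P i j) 0; first by rewrite mul0r.
  by rewrite -e' (negPf ne) mulr0.
- move=> w'; rewrite mxE word_of_rank; case: ifP => [/eqP //|_].
  by rewrite eqxx.
Qed.

(** On the content of a word, the sum of its letters: the quantity that decreases in the search for
    a highest weight vector. *)
Definition content_height d (c : {ffun 'I_d -> nat}) : nat := (\sum_i c i * i)%N.

Lemma content_swap n d (w : word n d) (s : 'S_d) :
  content [ffun l => s (w l)] = [ffun i => content w (s^-1%g i)].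
Proof.
apply/ffunP => i; rewrite !ffunE; apply: eq_card => l; rewrite !inE ffunE.
by rewrite -[RHS](inj_eq (@perm_inj _ s)) permKV.
Qed.

Lemma content_height_swap d (c : {ffun 'I_d -> nat}) (i j : 'I_d) :
  (i < j)%N -> (c i < c j)%N ->
  (content_height [ffun a => c ((tperm i j)^-1%g a)] < content_height c)%N.
Proof.
move=> ij cij; rewrite tpermV /content_height.
have ne : i != j by rewrite -val_eqE ltn_eqF.
rewrite (bigD1 i) //= (bigD1 j) /=; last by rewrite eq_sym.
rewrite [X in (_ < X)%N](bigD1 i) //= [X in (_ < _ + X)%N](bigD1 j) /=; last by rewrite eq_sym.
rewrite !ffunE tpermL tpermR !addnA.
rewrite (eq_bigr (fun a : 'I_d => (c a * a)%N)) => [|a /andP [ai aj]]; last first.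
  by rewrite ffunE tpermD // eq_sym.
rewrite ltn_add2r; move: (c i) (c j) (nat_of_ord i) (nat_of_ord j) ij cij => x y a b ab xy.
have -> : (x * a + y * b = y * a + x * b + (y - x) * (b - a))%N.
  by rewrite -{1 2}(subnKC (ltnW ab)) -{1 2}(subnKC (ltnW xy)); ring.
by rewrite -[X in (X < _)%N]addn0 ltn_add2l muln_gt0 !subn_gt0 xy.
Qed.

(** Descent among weight vectors in the kernel of P, which all tensor powers preserve. If a
    unitriangular U moves v, the difference has components of smaller height only; if the content
    increases somewhere, a transposition of letters lowers the height. A vector where neither
    applies is fixed and has a partition as its weight. *)
Lemma highest_weight_exists n d (P : 'M[C]_#|{: word n d}|)
    (v0 : 'cV[C]_#|{: word n d}|) :
  (forall X : 'M[C]_d, P *m tensor_power n X = tensor_power n X *m P) ->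
  v0 != 0 -> P *m v0 = 0 ->
  exists (lam : partition_of n d) v,
    [/\ v != 0, P *m v = 0 & highest_weight_vector (@tensor_power R n d d) (part lam) v].
Proof.
move=> hP v0n Pv0.
have neq0P (y : 'cV[C]_#|{: word n d}|) : y != 0 -> exists w, y (enum_rank w) 0 != 0.
  move=> yn; apply/existsP; apply: contraNT yn => /existsPn h; apply/eqP/colP => i.
  by rewrite mxE; apply/eqP; rewrite -[_ == _]negbK -(rank_word_of i) h.
have st := tensor_power_star R n d.
have step h : forall (v : 'cV[C]_#|{: word n d}|) c, v != 0 -> P *m v = 0 ->
    (forall w, v (enum_rank w) 0 != 0 -> content w = c) -> content_height c = h ->
    exists (lam : partition_of n d) v,
      [/\ v != 0, P *m v = 0 & highest_weight_vector (@tensor_power R n d d) (part lam) v].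
  elim/ltn_ind: h => h IH v c vn Pv vc hc.
  have descend (y : 'cV[C]_#|{: word n d}|) w : P *m y = 0 -> y (enum_rank w) 0 != 0 -> (content_height (content w) < h)%N ->
      exists (lam : partition_of n d) v,
      [/\ v != 0, P *m v = 0 & highest_weight_vector (@tensor_power R n d d) (part lam) v].
    move=> Py yw lt; have [u [un Pu uc]] := kernel_weight_component hP Py yw.
    exact: IH lt u _ un Pu uc erefl.
  have heightE (w : word n d) : content_height (content w) = (\sum_l w l)%N.
    by rewrite /content_height -(sum_content w (fun i => i : nat)).
  have [fixU|/boolp.existsNP [U /boolp.not_implyP [hU /eqP neU]]] :=
      boolp.pselect (fixed_by_unitriangular (@tensor_power R n d d) v); last first.
    have Py : P *m (tensor_power n U *m v - v) = 0 by rewrite mulmxBr mulmxA hP -mulmxA Pv mulmx0 subrr.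
    have [w yw] : exists w, (tensor_power n U *m v - v) (enum_rank w) 0 != 0.
      by apply: neq0P; rewrite subr_eq0.
    apply: (descend _ w Py yw).
    have [w' hw'] : exists w', (w' != w) && (tensor_power n U (enum_rank w) (enum_rank w') * v (enum_rank w') 0 != 0).
      apply/existsP; apply: contraNT yw => /existsPn e.
      rewrite mxE [X in X + _]mxE (bigD1 (enum_rank w)) //= [X in _ * _ + X]big1 => [|j ne].
        rewrite mxE word_of_rank big1 => [|l _]; last exact: hU.1.
        by rewrite mul1r addr0 mxE subrr.
      have := e (word_of j); rewrite rank_word_of negb_and negbK => /orP [/eqP ej|].
        by rewrite -ej rank_word_of eqxx in ne.
      by rewrite negbK => /eqP.
    case/andP: hw' => ne; rewrite mulf_eq0 negb_or => /andP [Uw vw'].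
    have [e|lt] := tensor_power_unitriangular hU Uw; first by rewrite e eqxx in ne.
    by rewrite heightE -hc -(vc _ vw') heightE.
  have [/existsP [[i j] /andP [/= ij cij]]|] :=
      boolP [exists p : 'I_d * 'I_d, (p.1 < p.2)%N && (c p.1 < c p.2)%N].
    pose X : 'M[C]_d := perm_mx (tperm i j).
    have XX : X *m X = 1%:M by rewrite /X -perm_mxM tperm2 perm_mx1.
    have Py : P *m (tensor_power n X *m v) = 0 by rewrite mulmxA hP -mulmxA Pv mulmx0.
    have [w yw] : exists w, (tensor_power n X *m v) (enum_rank w) 0 != 0.
      apply: neq0P; apply: contraNneq vn => e.
      by rewrite -[v]mul1mx -(tensor_power1 R n d) -XX (star_repM st) -mulmxA e mulmx0.
    apply: (descend _ w Py yw).
    have [w' hw'] : exists w', tensor_power n X (enum_rank w) (enum_rank w') * v (enum_rank w') 0 != 0.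
      apply/existsP; apply: contraNT yw => /existsPn e; rewrite mxE big1 // => a _.
      by have := e (word_of a); rewrite rank_word_of negbK => /eqP.
    move: hw'; rewrite mulf_eq0 negb_or => /andP [Xw /vc e].
    have -> : w = [ffun l => tperm i j (w' l)].
      apply/ffunP => l; rewrite ffunE; move: Xw; rewrite mxE !word_of_rank => /prodf_neq0 /(_ l isT).
      rewrite !mxE; have [<-|_] := eqVneq (tperm i j (w l)) (w' l); last by rewrite eqxx.
      by rewrite tpermK.
    by rewrite content_swap e -hc; exact: content_height_swap.
  move=> /existsPn dom.
  have [w0 vw0] := neq0P _ vn.
  have sum_c : (\sum_i c i = n)%N.
    rewrite -(vc _ vw0) -[RHS]card_ord -sum1_card (sum_content w0 (fun=> 1%N)).
    by apply: eq_bigr => i _; rewrite muln1.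
  have c_le i : (c i < n.+1)%N by rewrite ltnS -sum_c (bigD1 i) //= leq_addr.
  pose lam0 : {ffun 'I_d -> 'I_n.+1} := [ffun i => Ordinal (c_le i)].
  have hlam : is_partition lam0.
    apply/andP; split; last by apply/eqP; rewrite -[RHS]sum_c; apply: eq_bigr => i _; rewrite ffunE.
    apply/forallP => i; apply/forallP => j; apply/implyP; rewrite !ffunE /= leq_eqVlt => /orP [/eqP/val_inj -> //|ij].
    by have := dom (i, j); rewrite /= ij /= -leqNgt.
  exists (exist _ lam0 hlam), v; split => //; split => // t _.
  rewrite tensor_power_diag mul_diag_mx; apply/colP => i; rewrite !mxE.
  have [->|vi] := eqVneq (v i 0) 0; first by rewrite !mulr0.
  congr (_ * _); rewrite (vc (word_of i)) ?rank_word_of //; apply: eq_bigr => a _.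
  by rewrite /part /= ffunE.
have [w0 vw0] := neq0P _ v0n.
have [u [un Pu uc]] := kernel_weight_component hP Pv0 vw0.
exact: step _ u _ un Pu uc erefl.
Qed.

End HighestWeightExists.

(** * Schur-Weyl duality *)

Section SchurWeyl.
Variable R : realType.
Local Notation C := R[i].

Local Notation word n d := {ffun 'I_n -> 'I_d}.

Definition orbit_mx d D (q : 'M[C]_d -> 'M[C]_D) (v : 'cV[C]_D) r (X : 'I_r -> 'M[C]_d) :
  'M[C]_(D, r) := \matrix_(i, j) (q (X j) *m v) i 0.

Lemma orbit_mx_col d D (q : 'M[C]_d -> 'M[C]_D) v r (X : 'I_r -> 'M[C]_d) j :
  orbit_mx q v X *m delta_mx j 0 = q (X j) *m v.
Proof. by rewrite -colE; apply/colP => i; rewrite !mxE. Qed.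

Lemma eq_mx_delta D r (A B : 'M[C]_(D, r)) :
  (forall j, A *m delta_mx j (0 : 'I_1) = B *m delta_mx j 0) -> A = B.
Proof.
move=> h; apply/matrixP => i j; have /colP /(_ i) := h j.
by rewrite -!colE !mxE.
Qed.

Lemma adj_orbit_mul d D (q : 'M[C]_d -> 'M[C]_D) (v w : 'cV[C]_D) r s
    (X : 'I_r -> 'M[C]_d) (Y : 'I_s -> 'M[C]_d) i j :
  star_representation q ->
  (adjmx (orbit_mx q v X) *m orbit_mx q w Y) i j =
  (adjmx v *m q (adjmx (X i) *m Y j) *m w) 0 0.
Proof.
move=> sq; rewrite (star_repM sq) (star_rep_adj sq) mulmxA -adjmx_mul -mulmxA !mxE.
by apply: eq_bigr => k _; rewrite !adjmxE !mxE.
Qed.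

(** A finite part of the orbit spans a stable subspace containing v, hence everything; K is a right
    inverse recording this. *)
Lemma orbit_spans d D (q : 'M[C]_d -> 'M[C]_D) (v : 'cV[C]_D) :
  star_representation q -> irreducible_representation q -> v != 0 ->
  exists r, exists (X : 'I_r -> 'M[C]_d) (K : 'M[C]_(r, D)), orbit_mx q v X *m K = 1%:M.
Proof.
move=> sq [_ irr] v0.
have [r [X hX]] : exists r (X : 'I_r -> 'M[C]_d), forall Y, ((q Y *m v)^T <= (orbit_mx q v X)^T)%MS.
  (* As long as some orbit vector lies outside the span, adding it raises the rank, which cannot
     reach [D.+1]. *)
  have step k : (exists r (X : 'I_r -> 'M[C]_d), forall Y, ((q Y *m v)^T <= (orbit_mx q v X)^T)%MS) \/
      (exists r (X : 'I_r -> 'M[C]_d), (k <= \rank (orbit_mx q v X)^T)%N).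
    elim: k => [|k [IH|[r [X hX]]]]; [|by left|].
      by right; exists 0%N, (fun=> 0).
    have [h|/boolp.existsNP [Y /negP hY]] :=
        boolp.pselect (forall Y, ((q Y *m v)^T <= (orbit_mx q v X)^T)%MS).
      by left; exists r, X.
    right; exists (r + 1)%N, (fun i => match split i with inl j => X j | inr _ => Y end).
    set Z := fun i => _.
    have Zl c : Z (lshift 1 c) = X c by rewrite /Z (unsplitK (inl _ c)).
    have Zr c : Z (rshift r c) = Y by rewrite /Z (unsplitK (inr _ c)).
    have -> : (orbit_mx q v Z)^T = col_mx (orbit_mx q v X)^T (q Y *m v)^T.
      apply/matrixP => a b; case: (split_ordP a) => c ->.
        by rewrite col_mxEu !mxE Zl.
      by rewrite col_mxEd (ord1 c) !mxE Zr.
    rewrite -addsmxE; apply: leq_ltn_trans hX _.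
    rewrite ltn_neqAle mxrankS ?addsmxSl // andbT; apply: contra hY => /eqP e.
    apply: submx_trans (addsmxSr (orbit_mx q v X)^T _) _.
    by rewrite -(geq_leqif (mxrank_leqif_sup (addsmxSl _ _))) e.
  have [//|[r [X]]] := step D.+1.
  by rewrite leqNgt ltnS rank_leq_col.
pose Q := (orbit_mx q v X)^T.
have [|W0|full] := irr <<Q>>%MS; first last.
- have /row_fullP [B hB] : row_full Q by move: full; rewrite /row_full genmxE.
  exists r, X, B^T; apply: trmx_inj.
  by rewrite trmx_mul trmxK trmx1.
- have := hX 1%:M; rewrite (star_rep1 sq) mul1mx -(genmxE Q) W0 submx0 => /eqP e.
  by case/eqP: v0; apply: trmx_inj; rewrite e trmx0.
move=> Y _; rewrite (eqmxMr _ (genmxE Q)) genmxE; apply/row_subP => i.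
rewrite rowE mulmxA -rowE; have -> : row i Q = (q (X i) *m v)^T by apply/rowP => j; rewrite !mxE.
by rewrite -trmx_mul mulmxA -(star_repM sq).
Qed.

(** The orbits of [v] and [e] have equal Gram matrices by [highest_weight_coefficient], so q(X) v ->
    p(X) e extends to an isometry. The last clause records that its image lies in the span of the
    orbit of [e], from which orthogonality of different copies is deduced. *)
Lemma intertwiner_exists d D D' (q : 'M[C]_d -> 'M[C]_D) (p : 'M[C]_d -> 'M[C]_D') mu v e :
  star_representation q -> star_representation p -> irreducible_representation q ->
  highest_weight_vector q mu v -> highest_weight_vector p mu e ->
  (adjmx v *m v) 0 0 = 1 -> (adjmx e *m e) 0 0 = 1 ->
  exists phi : 'M[C]_(D', D),
    [/\ adjmx phi *m phi = 1%:M, forall X, p X *m phi = phi *m q X, phi *m v = e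
      & exists r (X : 'I_r -> 'M[C]_d) (K : 'M[C]_(r, D)), phi = orbit_mx p e X *m K].
Proof.
move=> sq sp irr hv he v1 e1.
have v0 : v != 0.
  by apply: contra_eq_neq v1 => ->; rewrite mulmx0 mxE eq_sym oner_neq0.
have [r [X [K QK]]] := orbit_spans sq irr v0.
have coef Y : (adjmx v *m q Y *m v) 0 0 = (adjmx e *m p Y *m e) 0 0.
  have := highest_weight_coefficient sq sp hv.2 he.2 hv he Y.
  by rewrite v1 e1 !mul1r.
have gram s t (Y : 'I_s -> 'M[C]_d) (Z : 'I_t -> 'M[C]_d) :
    adjmx (orbit_mx q v Y) *m orbit_mx q v Z = adjmx (orbit_mx p e Y) *m orbit_mx p e Z.
  by apply/matrixP => i j; rewrite !adj_orbit_mul.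
pose phi := orbit_mx p e X *m K.
have phiE Y : phi *m (q Y *m v) = p Y *m e.
  pose y : 'I_1 -> 'M[C]_d := fun=> Y.
  have yq : q Y *m v = orbit_mx q v y by apply/matrixP => i j; rewrite ord1 !mxE; apply: eq_bigr.
  have yp : p Y *m e = orbit_mx p e y by apply/matrixP => i j; rewrite ord1 !mxE; apply: eq_bigr.
  rewrite yq yp; apply/eqP; rewrite -subr_eq0; apply/eqP/adj_mul_eq0.
  pose c := K *m orbit_mx q v y.
  have -> : phi *m orbit_mx q v y = orbit_mx p e X *m c by rewrite /phi /c mulmxA.
  have cq : orbit_mx q v X *m c = orbit_mx q v y by rewrite /c mulmxA QK mul1mx.
  rewrite adjmxB adjmx_mul mulmxBl !mulmxBr -!mulmxA (mulmxA _ (orbit_mx p e X) c) -!gram.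
  rewrite -[adjmx (orbit_mx q v X) *m _ *m c]mulmxA cq.
  rewrite (mulmxA (adjmx (orbit_mx p e y))) -!gram -[_ *m _ *m c]mulmxA cq.
  by rewrite !subrr.
have phiV : phi *m v = e.
  by have := phiE 1%:M; rewrite (star_rep1 sq) (star_rep1 sp) !mul1mx.
have phiX : phi *m orbit_mx q v X = orbit_mx p e X.
  by apply: eq_mx_delta => j; rewrite -mulmxA !orbit_mx_col phiE.
have phiK : phi = orbit_mx p e X *m K by [].
clearbody phi; exists phi; split => //; last by exists r, X, K.
  have -> : adjmx phi *m phi = adjmx (phi *m orbit_mx q v X *m K) *m (phi *m orbit_mx q v X *m K).
    by rewrite -!mulmxA QK mulmx1.
  rewrite phiX adjmx_mul -mulmxA (mulmxA _ (orbit_mx p e X)) -gram.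
  by rewrite !mulmxA -adjmx_mul -mulmxA QK adjmx1 mulmx1.
move=> Y; rewrite -[LHS]mulmx1 -[RHS]mulmx1 -QK !mulmxA; congr (_ *m K).
apply: eq_mx_delta => j.
rewrite -!mulmxA !orbit_mx_col phiE (mulmxA (q Y)) -(star_repM sq) phiE.
by rewrite (star_repM sp) mulmxA.
Qed.

(** A real diagonal matrix with one entry 2 acts self-adjointly, with distinct eigenvalues on the
    two vectors. *)
Lemma highest_weight_orthogonal d D (p : 'M[C]_d -> 'M[C]_D) mu nu v w :
  star_representation p -> highest_weight_vector p mu v -> highest_weight_vector p nu w ->
  (exists i, mu i != nu i) -> (adjmx v *m w) 0 0 = 0.
Proof.
move=> sp hv hw [i hi].
pose t : 'rV[C]_d := \row_j (if j == i then 2 else 1).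
have t0 j : t 0 j != 0 by rewrite mxE; case: ifP; rewrite ?pnatr_eq0 ?oner_neq0.
have tE (c : 'I_d -> nat) : \prod_j t 0 j ^+ c j = 2 ^+ c i.
  rewrite (bigD1 i) //= mxE eqxx big1 ?mulr1 // => j /negPf h.
  by rewrite mxE h expr1n.
have th : adjmx (diag_mx t) = diag_mx t.
  rewrite adjmx_diag; congr diag_mx; apply/rowP => j; rewrite !mxE.
  by case: ifP; rewrite ?conjC_nat ?rmorph1.
have h : (2 ^+ nu i - 2 ^+ mu i) * (adjmx v *m w) 0 0 = 0.
  have e1 : (adjmx v *m p (diag_mx t) *m w) 0 0 = 2 ^+ nu i * (adjmx v *m w) 0 0.
    by rewrite -mulmxA hw.1 // tE -scalemxAr mxE.
  have e2 : (adjmx v *m p (diag_mx t) *m w) 0 0 = 2 ^+ mu i * (adjmx v *m w) 0 0.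
    rewrite -th (star_rep_adj sp) -adjmx_mul hv.1 // tE adjmxZ -scalemxAl mxE.
    by rewrite rmorphXn /= conjC_nat.
  by rewrite mulrBl -e1 e2 subrr.
move/eqP: h; rewrite mulf_eq0 => /orP [|/eqP //].
by rewrite subr_eq0 -!natrX eqr_nat eqn_exp2l // eq_sym (negPf hi).
Qed.

(** The index [a] is a partition with the number of a vector in an orthonormal basis of its Specht
    module; this makes the multiplicity [dim_specht]. *)
Lemma schur_weyl n d (D : partition_of n d -> nat)
    (q : forall lam : partition_of n d, 'M[C]_d -> 'M[C]_(D lam)) :
  (forall lam, is_weyl_representation lam (q lam)) ->
  exists phi : forall a : {lam : partition_of n d & 'I_(dim_specht R lam)},
      'M[C]_(#|{: word n d}|, D (tag a)),
    [/\ forall a, adjmx (phi a) *m phi a = 1%:M,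
        forall a X, tensor_power n X *m phi a = phi a *m q (tag a) X
      & \sum_a phi a *m adjmx (phi a) = 1%:M].
Proof.
move=> hq.
have sq lam : star_representation (q lam).
  by have [rq _ _ uq] := hq lam; exact: weyl_star_representation.
have st := tensor_power_star R n d.
have hv lam : exists v, highest_weight_vector (q lam) (part lam) v /\ (adjmx v *m v) 0 0 = 1.
  have [_ _ [v v0 [hw hf]] _] := hq lam.
  pose c := (sqrtC ((adjmx v *m v) 0 0))^-1.
  exists (c *: v); split; first split=> [t t0|U [U1 U0]].
  - by rewrite -scalemxAr (hw _ t0) !scalerA mulrC.
  - by rewrite -scalemxAr hf.
  have c_real : c^* = c by rewrite conj_Creal // ger0_real // invr_ge0 sqrtC_ge0 adj_mul_ge0.
  rewrite adjmxZ -scalemxAl -scalemxAr !mxE c_real mulrA -expr2 exprVn sqrtCK.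
  have := adj_mul_gt0 v0; rewrite mxE => h; by rewrite mulVf // gt_eqF.
pose v lam := sval (boolp.cid (hv lam)).
have vP lam : highest_weight_vector (q lam) (part lam) (v lam) /\ (adjmx (v lam) *m v lam) 0 0 = 1
  := svalP (boolp.cid (hv lam)).
pose B (lam : partition_of n d) := sval (boolp.cid (orthonormal_basis (specht_module R lam))).
have BP (lam : partition_of n d) : adjmx (B lam) *m B lam = 1%:M /\
    forall f, f \in specht_module R lam <-> B lam *m adjmx (B lam) *m word_vec f = word_vec f
  := svalP (boolp.cid (orthonormal_basis (specht_module R lam))).
pose e (a : {lam : partition_of n d & 'I_(dim_specht R lam)}) : 'cV[C]_#|{: word n d}| :=
  B (tag a) *m delta_mx (tagged a) 0.
have he a : highest_weight_vector (@tensor_power R n d d) (part (tag a)) (e a).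
  rewrite -[e a]word_funK; apply/specht_highest_weight/(BP (tag a)).2; rewrite word_funK /e.
  by rewrite -mulmxA (mulmxA _ (B _)) (BP _).1 mul1mx.
have ee a b : (adjmx (e a) *m e b) 0 0 = (a == b)%:R.
  have [eab|neab] := eqVneq (tag a) (tag b); last first.
    have -> : (a == b) = false by apply: contra_neqF neab => /eqP ->.
    apply: (highest_weight_orthogonal st (he a) (he b)).
    apply/existsP; apply: contraNT neab => /existsPn h; apply/eqP/val_inj/ffunP => i.
    by apply/val_inj/eqP; rewrite -[_ == _]negbK h.
  case: a b eab => lam i [lam' j] /= eab; case: lam' / eab j => j.
  rewrite eq_Tagged /= /e /= adjmx_mul -mulmxA (mulmxA _ (B lam)) (BP lam).1 mul1mx adjmx_delta.
  by rewrite mul_delta_mx_cond; case: eqP => _; rewrite ?mulr1n ?mulr0n !mxE ?eqxx.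
have hphi a : exists phi : 'M[C]_(#|{: word n d}|, D (tag a)),
    [/\ adjmx phi *m phi = 1%:M, forall X, tensor_power n X *m phi = phi *m q (tag a) X,
        phi *m v (tag a) = e a
      & exists r (X : 'I_r -> 'M[C]_d) (K : 'M[C]_(r, D (tag a))),
          phi = orbit_mx (@tensor_power R n d d) (e a) X *m K].
  have [_ irr _ _] := hq (tag a).
  apply: intertwiner_exists (sq _) st irr (vP _).1 (he a) (vP _).2 _.
  by rewrite ee eqxx.
pose phi a := sval (boolp.cid (hphi a)).
have phiP a : [/\ adjmx (phi a) *m phi a = 1%:M,
    forall X, tensor_power n X *m phi a = phi a *m q (tag a) X,
    phi a *m v (tag a) = e a
  & exists r (X : 'I_r -> 'M[C]_d) (K : 'M[C]_(r, D (tag a))),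
          phi a = orbit_mx (@tensor_power R n d d) (e a) X *m K] := svalP (boolp.cid (hphi a)).
have eE a : e a = B (tag a) *m delta_mx (tagged a) 0 by [].
clearbody phi e v B.
(* Every coefficient between the orbits of [e a] and [e b] is a multiple of their inner product,
   which is 0. *)
have phi_orth a b : a != b -> adjmx (phi a) *m phi b = 0.
  move=> neab; have [_ _ _ [r [X [K ->]]]] := phiP a; have [_ _ _ [s [Y [L ->]]]] := phiP b.
  rewrite adjmx_mul -mulmxA (mulmxA (adjmx (orbit_mx _ _ _))).
  suff -> : adjmx (orbit_mx (tensor_power n (e:=d)) (e a) X) *m
      orbit_mx (tensor_power n (e:=d)) (e b) Y = 0 by rewrite mul0mx mulmx0.
  apply/matrixP => i j; rewrite adj_orbit_mul // [RHS]mxE.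
  have := highest_weight_coefficient st st (he a).2 (he b).2 (he b) (he b) (adjmx (X i) *m Y j).
  by rewrite !ee eqxx (negPf neab) mul1r mul0r.
exists phi; split=> [a|a X|]; [by have [] := phiP a | by have [_ ->] := phiP a |].
set P := \sum_a _.
have Pphi b : P *m phi b = phi b.
  rewrite /P mulmx_suml (bigD1 b) //= big1 ?addr0 => [|a ne].
    by rewrite -mulmxA; have [-> _ _ _] := phiP b; rewrite mulmx1.
  by rewrite -mulmxA phi_orth // mulmx0.
have PP : P *m P = P.
  by rewrite {2 3}/P mulmx_sumr; apply: eq_bigr => a _; rewrite mulmxA Pphi.
(* The second half of commutation is the adjoint of the intertwining relation at [adjmx X]. *)
have comm X : P *m tensor_power n X = tensor_power n X *m P.
  rewrite /P mulmx_suml mulmx_sumr; apply: eq_bigr => a _; have [_ hX _ _] := phiP a.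
  rewrite mulmxA hX -!mulmxA; congr (_ *m _).
  have := congr1 (@adjmx R _ _) (hX (adjmx X)).
  by rewrite !adjmx_mul adj_tensor_power adjmxK (star_rep_adj (sq _)) adjmxK.
apply/eqP; rewrite eq_sym -subr_eq0; apply/negPn/negP => nz.
have [u hu] : exists u : 'cV[C]_#|{: word n d}|, (1%:M - P) *m u != 0.
  have [j hj] : exists j, col j (1%:M - P) != 0.
    apply/existsP; apply: contraNT nz => /existsPn h; apply/eqP/matrixP => i j.
    have := h j; rewrite negbK => /eqP /colP /(_ i).
    by rewrite [LHS]mxE => ->; rewrite !mxE.
  by exists (delta_mx j 0); rewrite -colE.
have Pu : P *m ((1%:M - P) *m u) = 0 by rewrite mulmxA mulmxBr mulmx1 PP subrr mul0mx.
have [lam [y [y0 Py hy]]] := highest_weight_exists comm hu Pu.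
have By := highest_weight_in_specht (BP lam).1 (BP lam).2 hy.
case/eqP: y0; rewrite -By.
(* [y] lies in the range of [B lam], whose columns are the vectors [e a] in the images of the
   [phi a]; so P fixes [y], while [P *m y = 0]. *)
suff PB : P *m B lam = B lam by rewrite -{1}PB -(mulmxA P) -(mulmxA P) By Py.
apply: eq_mx_delta => j; rewrite -mulmxA.
pose a : {lam : partition_of n d & 'I_(dim_specht R lam)} := Tagged _ (j : 'I_(dim_specht R lam)).
have -> : B lam *m delta_mx j 0 = phi a *m v (tag a).
  by have [_ _ -> _] := phiP a; rewrite eE.
by rewrite mulmxA (Pphi a).
Qed.

End SchurWeyl.

(** * Proof of the theorem *)

Section Assembly.
Variable R : realType.
Local Notation C := R[i].

Local Notation word n d := {ffun 'I_n -> 'I_d}.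

(** Row and column indices of an iterated Kronecker product are read as words, the first letter
    being the outermost factor. *)
Lemma ntensmx_digits n d : exists dig : 'I_(d ^ n.+1) -> word n.+1 d, injective dig /\
  forall (X : 'M[C]_d) i j, ntensmx X n.+1 i j = \prod_l X (dig i l) (dig j l).
Proof.
elim: n => [|n [dig [digI digE]]].
  exists (fun i => [ffun=> i]); split=> [i j /ffunP /(_ ord0)|X i j]; first by rewrite !ffunE.
  by rewrite big_ord1 !ffunE.
exists (fun i => [ffun l => oapp (dig (mxtens_unindex i).2) (mxtens_unindex i).1 (unlift ord0 l)]).
split=> [i j /ffunP e|X i j].
  rewrite -(mxtens_unindexK i) -(mxtens_unindexK j).
  have e1 : (mxtens_unindex i).1 = (mxtens_unindex j).1.
    by have := e ord0; rewrite !ffunE unlift_none.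
  have e2 : (mxtens_unindex i).2 = (mxtens_unindex j).2.
    by apply/digI/ffunP => l; have := e (lift ord0 l); rewrite !ffunE liftK.
  by move: e1 e2; case: (mxtens_unindex i) (mxtens_unindex j) => a b [a' b'] /= -> ->.
rewrite ntensmxSS big_ord_recl !ffunE !unlift_none /= mxE digE; congr (_ * _).
by apply: eq_bigr => l _; rewrite !ffunE !liftK.
Qed.

Lemma ntensmx_tensor_power n d : exists E : 'M[C]_(d ^ n.+1, #|{: word n.+1 d}|),
  [/\ adjmx E *m E = 1%:M, E *m adjmx E = 1%:M
    & forall X : 'M[C]_d, ntensmx X n.+1 *m E = E *m tensor_power n.+1 X].
Proof.
have [dig [digI digE]] := ntensmx_digits n d.
have [g digK gK] : bijective dig.
  by apply: inj_card_bij => //; rewrite card_ffun !card_ord.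
pose E : 'M[C]_(d ^ n.+1, #|{: word n.+1 d}|) := \matrix_(i, j) (dig i == word_of j)%:R.
have mulE m (A : 'M[C]_(m, _)) i j : (A *m E) i j = A i (g (word_of j)).
  rewrite mxE (bigD1 (g (word_of j))) //= mxE gK eqxx mulr1 [X in _ + X]big1 ?addr0 // => k ne.
  rewrite mxE; case: eqP => [e|_]; last by rewrite mulr0.
  by rewrite -e digK eqxx in ne.
have Emul m (A : 'M[C]_(_, m)) i j : (E *m A) i j = A (enum_rank (dig i)) j.
  rewrite mxE (bigD1 (enum_rank (dig i))) //= mxE word_of_rank eqxx mul1r.
  rewrite [X in _ + X]big1 ?addr0 // => k ne.
  rewrite mxE; case: eqP => [e|_]; last by rewrite mul0r.
  by rewrite e rank_word_of eqxx in ne.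
exists E; split.
- apply/matrixP => i j; rewrite mulE adjmxE !mxE gK conjC_nat.
  by rewrite (inj_eq (@word_of_inj n.+1 d)) eq_sym.
- by apply/matrixP => i j; rewrite Emul adjmxE !mxE word_of_rank conjC_nat (inj_eq digI) eq_sym.
- move=> X; apply/matrixP => i j; rewrite mulE Emul digE mxE word_of_rank.
  by apply: eq_bigr => l _; rewrite gK.
Qed.

Lemma psd_sum n I (r : seq I) (F : I -> 'M[C]_n) :
  (forall i, psdmx (F i)) -> psdmx (\sum_(i <- r) F i).
Proof.
move=> hF; split=> [|v].
  by rewrite adjmx_sum; apply: eq_bigr => i _; have [] := hF i.
rewrite mulmx_sumr mulmx_suml summxE; apply: sumr_ge0 => i _.
by have [_] := hF i.
Qed.

(** The corrections \tr A * log2 (\tr A) of [entropy_scale] cancel in the difference. If the trace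
    is 0, both matrices vanish and so do both sides; this covers the terms with zero weight. *)
Lemma psd_entropy_normalize m n (A : 'M[C]_m) (B : 'M[C]_n) :
  psdmx A -> psdmx B -> \tr A = \tr B ->
  (entropy A - entropy B)%:C =
  \tr A * (entropy ((\tr A)^-1 *: A) - entropy ((\tr A)^-1 *: B))%:C.
Proof.
move=> pA pB eAB.
have [P [a [uP eA a0]]] := psd_diagonalize pA.
have [Q [b [uQ eB b0]]] := psd_diagonalize pB.
have trA : \tr A = \sum_i a 0 i by rewrite eA (mxtrace_conj _ (iffRL (unitary_adjP P) uP)) mxtrace_diag.
have trB : \tr A = \sum_i b 0 i by rewrite eAB eB (mxtrace_conj _ (iffRL (unitary_adjP Q) uQ)) mxtrace_diag.
have tr0 : 0 <= \tr A by rewrite trA sumr_ge0.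
have zero k (d : 'rV[C]_k) (U X : 'M[C]_k) : X = adjmx U *m diag_mx d *m U ->
    (forall i, 0 <= d 0 i) -> \sum_i d 0 i = 0 -> entropy X = 0.
  move=> -> d0 sd; have -> : d = 0.
    by apply/rowP => i; rewrite mxE; have /psumr_eq0P := sd; apply.
  by rewrite linear0 mulmx0 mul0mx entropy0.
have [t0|tn0] := eqVneq (\tr A) 0.
  by rewrite (zero _ _ _ _ eA a0) -?trA // (zero _ _ _ _ eB b0) -?trB // t0 mul0r subrr.
pose c := complex.Re (\tr A); have ec : \tr A = c%:C by rewrite RRe_real // ger0_real.
have c0 : 0 < c by rewrite -ltcR -ec lt_def tn0.
rewrite -(invmx_unitary_adj uP) in eA; rewrite -(invmx_unitary_adj uQ) in eB.
have e1 := entropy_scale c0 (psd_hermitian pA) (unitarymx_unit uP) eA a0.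
have e2 := entropy_scale c0 (psd_hermitian pB) (unitarymx_unit uQ) eB b0.
rewrite -eAB -ec in e2; rewrite -ec in e1.
rewrite {1}ec -(rmorphM (real_complex R)) mulrBr !(rmorphB (real_complex R)) /= e1 e2.
by rewrite opprD addrACA subrr addr0.
Qed.

Lemma entropy_reindex m n (f : 'I_m -> 'I_n) (A : 'M[C]_n) :
  bijective f -> psdmx A ->
  let B := \matrix_(i, j) A (f i) (f j) in
  [/\ psdmx B, entropy B = entropy A & \tr B = \tr A].
Proof.
move=> [g fK gK] pA B.
pose E : 'M[C]_(n, m) := \matrix_(i, j) (i == f j)%:R.
have mulE p (X : 'M[C]_(p, n)) i j : (X *m E) i j = X i (f j).
  rewrite mxE (bigD1 (f j)) //= mxE eqxx mulr1 [X in _ + X]big1 ?addr0 // => k /negPf ne.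
  by rewrite mxE ne mulr0.
have EE : E *m adjmx E = 1%:M.
  apply/matrixP => i j; rewrite mxE (bigD1 (g i)) //= [X in _ + X]big1 ?addr0 => [|k ne].
    by rewrite adjmxE !mxE gK eqxx mul1r conjC_nat eq_sym.
  rewrite mxE; case: eqP => [e|_]; last by rewrite mul0r.
  by rewrite e fK eqxx in ne.
have eB : B = adjmx E *m A *m E.
  apply/matrixP => i j; rewrite mulE mxE -[adjmx E *m A]adjmxK adjmx_mul adjmxK adjmxE mulE.
  by rewrite adjmxE conjCK.
have pB : psdmx B by rewrite eB; exact: psd_conj.
split => //; last by rewrite eB mxtrace_mulC mulmxA EE mul1mx.
rewrite eB -mulmxA -[in RHS](mul1mx A); apply: entropy_mulC.
- by rewrite mulmxA -eB; exact: psd_hermitian.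
- by rewrite mul1mx; exact: psd_hermitian.
- by rewrite -mulmxA EE.
Qed.

(** [mxblock] runs over the block number first and the coordinate second, the Kronecker convention
    the other way round. *)
Lemma mxblock_index_bij D k : exists2 f : 'I_(\sum_(i < k) D) -> 'I_(D * k), bijective f &
  forall s, f s = mxtens_index ((tagnat.sig2 s : 'I_D), tagnat.sig1 s).
Proof.
exists (fun s => mxtens_index ((tagnat.sig2 s : 'I_D), tagnat.sig1 s)) => //.
apply: inj_card_bij => [s s' e|]; last by rewrite !card_ord sum_nat_const card_ord mulnC.
have [e2 e1] := can_inj (@mxtens_indexK _ _) e.
apply: tagnat.sig_inj; rewrite !tagnat.sigE12.
move: (tagnat.sig1 s) (tagnat.sig2 s) (tagnat.sig1 s') (tagnat.sig2 s') e1 e2 => i c i' c' e1.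
by case: i' / e1 c' => c' ->.
Qed.

End Assembly.

(** * Block matrices with the reference system as second tensor factor *)

Section TensorChannel.
Variable R : realType.
Local Notation C := R[i].

Lemma block_tens_mul m n p k (F : 'I_k -> 'I_k -> 'M[C]_(m, n)) (A : 'M[C]_(n, p)) :
  (\sum_i \sum_j (F i j *t delta_mx i j)) *m (A *t 1%:M) =
  \sum_i \sum_j ((F i j *m A) *t delta_mx i j).
Proof.
rewrite mulmx_suml; apply: eq_bigr => i _; rewrite mulmx_suml; apply: eq_bigr => j _.
by rewrite tensmx_mul mulmx1.
Qed.

Lemma tens_block_mul m n p k (F : 'I_k -> 'I_k -> 'M[C]_(m, n)) (A : 'M[C]_(p, m)) :
  (A *t 1%:M) *m (\sum_i \sum_j (F i j *t delta_mx i j)) =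
  \sum_i \sum_j ((A *m F i j) *t delta_mx i j).
Proof.
rewrite mulmx_sumr; apply: eq_bigr => i _; rewrite mulmx_sumr; apply: eq_bigr => j _.
by rewrite tensmx_mul mul1mx.
Qed.

Lemma tens_block_trace m k (F : 'I_k -> 'I_k -> 'M[C]_m) :
  \tr (\sum_i \sum_j (F i j *t delta_mx i j)) = \sum_i \tr (F i i).
Proof.
rewrite /mxtrace (reindex (fun p : 'I_m * 'I_k => mxtens_index p)) /=; last first.
  by exists (@mxtens_unindex m k) => p _; rewrite (mxtens_indexK, mxtens_unindexK).
transitivity (\sum_(p : 'I_m * 'I_k) F p.2 p.2 p.1 p.1).
  by apply: eq_bigr => -[a i] _; rewrite block_entry.
by rewrite -(pair_bigA _ (fun a i => F i i a a)) exchange_big.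
Qed.

Lemma tensmx1 m n : (1%:M : 'M[C]_m) *t (1%:M : 'M[C]_n) = 1%:M.
Proof.
apply/matrixP => p q; case: (mxtens_indexP p) => b i; case: (mxtens_indexP q) => c j.
by rewrite tensmxE !mxE -natrM mulnb (can_eq (@mxtens_indexK _ _)) xpair_eqE.
Qed.

Lemma psd_block_gram m e k (G : 'I_k -> 'M[C]_(m, e)) :
  psdmx (\sum_i \sum_j ((G i *m adjmx (G j)) *t (delta_mx i j : 'M[C]_k))).
Proof.
pose Z := \sum_i (G i *t (delta_mx i 0 : 'cV[C]_k)).
suff -> : \sum_i \sum_j ((G i *m adjmx (G j)) *t (delta_mx i j : 'M[C]_k)) = Z *m adjmx Z.
  exact: psd_gram.
rewrite mulmx_suml; apply: eq_bigr => i _; rewrite adjmx_sum mulmx_sumr.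
by apply: eq_bigr => j _; rewrite adjmx_tens tensmx_mul adjmx_delta mul_delta_mx.
Qed.

End TensorChannel.

Lemma sum_tag (V : nmodType) (I : finType) (m : I -> nat) (f : I -> V) :
  \sum_(a : {i : I & 'I_(m i)}) f (tag a) = \sum_i f i *+ m i.
Proof.
transitivity (\sum_i \sum_(j < m i) f i); first by rewrite sig_big_dep.
by apply: eq_bigr => i _; rewrite sumr_const card_ord.
Qed.

Theorem theorem4p3 (R : realType) (dA dB n k : nat)
    (N : {linear 'M[R[i]]_dA -> 'M[R[i]]_dB})
    (psi : 'I_k -> 'cV[R[i]]_dA) (x : 'I_k -> R)
    (D : partition_of n dB -> nat)
    (q : forall lam : partition_of n dB, 'M[R[i]]_dB -> 'M[R[i]]_(D lam))
    (hN : quantum_channel N) (hn : (1 <= n)%N) (hk : (1 <= k)%N)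
    (hpsi : forall i, unit_vector (psi i))
    (hx0 : forall i, 0 <= x i) (hx1 : \sum_(i < k) x i = 1)
    (hq : forall lam, is_weyl_representation lam (q lam)) :
  let rho : 'M[R[i]]_(dA ^ n) :=
    \sum_(i < k) (x i)%:C *: ntensmx (ketbra (psi i) (psi i)) n in
  let sigma i j : 'M[R[i]]_dB := N (ketbra (psi i) (psi j)) in
  let qbar lam : R[i] := \sum_(i < k) (x i)%:C * \tr (q lam (sigma i i)) in
  let c lam : R[i] := qbar lam * (dim_specht R lam)%:R in
  let sigma_ lam : 'M[R[i]]_(D lam) :=
    (qbar lam)^-1 *: \sum_(i < k) (x i)%:C *: q lam (sigma i i) in
  let omega_ lam : 'M[R[i]]_(\sum_(i < k) D lam) :=
    (qbar lam)^-1 *: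
      \mxblock_(i < k, j < k) ((Num.sqrt (x i * x j))%:C *: q lam (sigma i j)) in
  (coherent_information (tens_pow N n) rho)%:C
  = \sum_(lam : partition_of n dB)
      c lam * (entropy (sigma_ lam) - entropy (omega_ lam))%:C.

Proof.
case: n hn D q hq => // {}n _ D q hq; move=> rho sigma qbar c sigma_ omega_.
have [cpN _] := hN; have lN : linear N := linearP N.
pose Nn := tens_pow N n.+1; have lNn : linear Nn := tens_pow_linear (n := n.+1) lN.
have hNn : hermitian_preserving Nn by exact/tens_pow_hermitian/cp_hermitian.
pose sx i j : R[i] := (Num.sqrt (x i * x j))%:C.
have sxE i j : sx i j = (Num.sqrt (x i))%:C * (Num.sqrt (x j))%:C.
  by rewrite /sx sqrtrM // rmorphM.
have sxx i : sx i i = (x i)%:C by rewrite /sx -expr2 sqrtr_sqr ger0_norm.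
have sqrtC i : ((Num.sqrt (x i))%:C)^* = (Num.sqrt (x i))%:C :> R[i].
  by rewrite conj_Creal // complex_real.
(* The weight is absorbed into the vector, so that [stack w] purifies [rho] and the output blocks
   carry the factors sqrt (x i * x j). *)
pose w i := (Num.sqrt (x i))%:C *: tens_vec (psi i) n.+1.
have kw i j : ketbra (w i) (w j) = sx i j *: ntensmx (ketbra (psi i) (psi j)) n.+1.
  by rewrite -ketbra_tens_vec /ketbra adjmxZ -scalemxAl -scalemxAr scalerA sqrtC sxE.
have Nkw i j : Nn (ketbra (w i) (w j)) = sx i j *: ntensmx (sigma i j) n.+1.
  by rewrite kw (linear_scale _ _ lNn) /Nn tens_pow_ntens.
have rhoE : rho = \sum_i ketbra (w i) (w i).
  by apply: eq_bigr => i _; rewrite kw sxx.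
have NrhoE : Nn rho = \sum_i (x i)%:C *: ntensmx (sigma i i) n.+1.
  by rewrite rhoE (linear_sum _ _ lNn); apply: eq_bigr => i _; rewrite Nkw sxx.
have purif : purification rho (stack w) by rewrite rhoE; exact: purification_stack.
rewrite (coherent_information_purification hNn purif) tens_map_stack // NrhoE.
have -> : \sum_i \sum_j (Nn (ketbra (w i) (w j)) *t (delta_mx i j : 'M_k)) =
    \sum_i \sum_j ((sx i j *: ntensmx (sigma i j) n.+1) *t delta_mx i j).
  by apply: eq_bigr => i _; apply: eq_bigr => j _; rewrite Nkw.
set Y := \sum_i _ *: _; set X := \sum_i \sum_j _.
(* The factorization of [sigma i j] into Gram factors passes to tensor powers, which gives
   positivity of both output states. *)
have [e [G eG]] := cp_gram psi lN cpN.
pose Gn i := (Num.sqrt (x i))%:C *: ntensmx (G i) n.+1.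
have GnE i j : sx i j *: ntensmx (sigma i j) n.+1 = Gn i *m adjmx (Gn j).
  rewrite /sigma eG ntensmx_mul -adj_ntensmx adjmxZ -scalemxAl -scalemxAr scalerA sqrtC.
  by rewrite sxE.
have pX : psdmx X.
  have -> : X = \sum_i \sum_j ((Gn i *m adjmx (Gn j)) *t delta_mx i j).
    by apply: eq_bigr => i _; apply: eq_bigr => j _; rewrite GnE.
  exact: psd_block_gram.
have pY : psdmx Y by apply: psd_sum => i; rewrite -sxx GnE; exact: psd_gram.
have [phi [phi1 phiq phiS]] := schur_weyl hq.
have [E [E1 E2 ET]] := ntensmx_tensor_power R n dB.
pose J a := E *m phi a.
have J1 a : adjmx (J a) *m J a = 1%:M.
  by rewrite adjmx_mul -mulmxA (mulmxA (adjmx E)) E1 mul1mx.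
have JJ : \sum_a J a *m adjmx (J a) = 1%:M.
  transitivity (E *m (\sum_a phi a *m adjmx (phi a)) *m adjmx E); last by rewrite phiS mulmx1.
  by rewrite mulmx_sumr mulmx_suml; apply: eq_bigr => a _; rewrite adjmx_mul !mulmxA.
have Jq a Z : ntensmx Z n.+1 *m J a = J a *m q (tag a) Z.
  by rewrite mulmxA ET -mulmxA phiq mulmxA.
pose Yq lam := \sum_i (x i)%:C *: q lam (sigma i i).
pose Xq lam : 'M[R[i]]_(D lam * k) := \sum_i \sum_j ((sx i j *: q lam (sigma i j)) *t delta_mx i j).
have YJ a : Y *m J a = J a *m Yq (tag a).
  rewrite mulmx_suml mulmx_sumr; apply: eq_bigr => i _.
  by rewrite -scalemxAl Jq scalemxAr.
have XJ a : X *m (J a *t 1%:M) = (J a *t 1%:M) *m Xq (tag a).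
  rewrite block_tens_mul tens_block_mul; apply: eq_bigr => i _; apply: eq_bigr => j _.
  by rewrite -scalemxAl Jq scalemxAr.
have J1' a : adjmx (J a *t (1%:M : 'M_k)) *m (J a *t 1%:M) = 1%:M.
  by rewrite adjmx_tens tensmx_mul J1 adjmx1 mulmx1 tensmx1.
have JJ' : \sum_a (J a *t (1%:M : 'M_k)) *m adjmx (J a *t 1%:M) = 1%:M.
  rewrite -tensmx1 -JJ tensmx_suml; apply: eq_bigr => a _.
  by rewrite adjmx_tens tensmx_mul adjmx1 mulmx1.
have pYq (a : {lam : partition_of n.+1 dB & 'I_(dim_specht R lam)}) : psdmx (Yq (tag a)).
  suff -> : Yq (tag a) = adjmx (J a) *m Y *m J a by exact: psd_conj.
  by rewrite -mulmxA YJ mulmxA J1 mul1mx.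
have pXq (a : {lam : partition_of n.+1 dB & 'I_(dim_specht R lam)}) : psdmx (Xq (tag a)).
  suff -> : Xq (tag a) = adjmx (J a *t 1%:M) *m X *m (J a *t 1%:M) by exact: psd_conj.
  by rewrite -mulmxA XJ mulmxA J1' mul1mx.
rewrite (entropy_direct_sum (psd_hermitian pY) (fun a => psd_hermitian (pYq a)) YJ J1 JJ).
rewrite (entropy_direct_sum (psd_hermitian pX) (fun a => psd_hermitian (pXq a)) XJ J1' JJ').
rewrite -sumrB raddf_sum /=.
rewrite (sum_tag (dim_specht R (n := n.+1) (d := dB))
  (fun lam => (entropy (Yq lam) - entropy (Xq lam))%:C)).
apply: eq_bigr => lam _.
(* Positivity of the blocks was obtained by compressing along some [J a], so an index [a] over [lam]
   has to exist; with multiplicity 0 both sides are 0. *)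
have [m0|m_gt0] := posnP (dim_specht R lam).
  by rewrite /c m0 mulr0 mul0r mulr0n.
pose a0 : {lam : partition_of n.+1 dB & 'I_(dim_specht R lam)} := Tagged _ (Ordinal m_gt0).
have {}pYq : psdmx (Yq lam) := pYq a0.
have {}pXq : psdmx (Xq lam) := pXq a0.
have trY : \tr (Yq lam) = qbar lam.
  by rewrite raddf_sum; apply: eq_bigr => i _; rewrite /= mxtraceZ.
(* Reordering the indices turns [Xq lam] into the block matrix of the statement with the same
   entropy and trace. *)
have [f bf fE] := mxblock_index_bij (D lam) k.
have [pB eB tB] := entropy_reindex bf pXq; set B := \matrix_(i, j) _ in pB eB tB.
have BE : B = \mxblock_(i < k, j < k) (sx i j *: q lam (sigma i j)).
  apply/matrixP => i j; rewrite !mxE !fE.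
  by rewrite (block_entry (fun i j => sx i j *: q lam (sigma i j))) mxE.
have trB : \tr (Yq lam) = \tr B.
  rewrite tB /Xq tens_block_trace raddf_sum; apply: eq_bigr => i _.
  by rewrite sxx.
have key := psd_entropy_normalize pYq pB trB.
rewrite eB trY BE in key.
rewrite key.
rewrite -[LHS]mulr_natr.
exact: mulrAC.
Qed.
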